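(* Assume (H1)–(H4) and (U) (for given $x_0\in\mathbb{R}^n$, $r>0$, $\theta>0$). Let $u\in C(\mathbb{R}^n\times[0,T))$ be a viscosity solution of (1.1)–(1.2). Then for any $t_0\in(0,T]$ satisfying $$\theta^2 e^{-((\frac{\beta}{2}+2)C_1+2K_3)t_0}-2C_1\beta t_0>0,$$ we have $$|p|\ \ge\ \sqrt{\theta^2 e^{-((\frac{\beta}{2}+2)C_1+2K_3)t}-2C_1\beta t}$$ for all $(x,t)\in\mathcal{E}(x_0,r)\cap(\mathbb{R}^n\times(0,t_0))$ and all $p\in D_x^-u(x,t)$.
   Context: Let $T>0$, $n\ge1$. $H:\mathbb{R}^n\times[0,T]\times\mathbb{R}\times\mathbb{R}^n\to\mathbb{R}$ is continuous and $u_0:\mathbb{R}^n\to\mathbb{R}$ is Lipschitz continuous. Problem (1.1)–(1.2): $u_t+H(x,t,u,D_xu)=0$ in $\mathbb{R}^n\times(0,T)$, $u(x,0)=u_0(x)$ on $\mathbb{R}^n$. Hypotheses: (H1) there exist $C_1\ge0$, $\beta\in\{0,1\}$ with $|H(x,t,u,p)-H(y,t,u,p)|\le C_1(\beta+|p|)|x-y|$ for all $t,u,p,x,y$. (H2) there exist $A_2,B_2\ge0$ with $|H(x,t,u,p)-H(x,t,u,q)|\le(A_2|x|+B_2)|p-q|$ for all $x,t,u,p,q$. (H3) there exists $K_3\ge0$ with $|H(x,t,u,p)-H(x,t,v,p)|\le K_3|u-v|$ for all $x,t,p,u,v$. (H4) $p\mapsto H(x,t,u,p)$ is convex for all $(x,t,u)$.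 (U) for the given $x_0\in\mathbb{R}^n$, $r>0$ there is $\theta>0$ with $|p|\ge\theta$ for all $x\in B_r(x_0)$ and $p\in D^-u_0(x)$. Viscosity solution: $u\in C(\mathbb{R}^n\times[0,T))$ with $u(\cdot,0)=u_0$, such that for every $\phi\in C^1(\mathbb{R}^n\times(0,T))$, if $u-\phi$ has a local maximum (resp. minimum) at $(x,t)\in\mathbb{R}^n\times(0,T)$ then $\phi_t(x,t)+H(x,t,u(x,t),D_x\phi(x,t))\le0$ (resp. $\ge0$). Subdifferential: for $f$ on $\mathbb{R}^m$, $D^-f(x)=\{D\phi(x):\phi\in C^1,\ f-\phi\text{ has a local minimum at }x\}$; for $u(x,t)$, $D_x^-u(x,t)=\{p:(p,\tau)\in D^-u(x,t)\text{ for some }\tau\}$. $B_r(x)$ is the open Euclidean ball. $R(x,t)=(\frac{B_2}{A_2}+|x|)(e^{A_2t}-1)$ if $A_2>0$, $R(x,t)=B_2t$ if $A_2=0$; $\mathcal{E}(x_0,r)=\{(x,t)\in B_r(x_0)\times(0,T): R(x,t)+|x-x_0|<r\}$. *)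

(* Defs.v *)
From HB Require Import structures.
From mathcomp Require Import all_boot all_order all_algebra.
From mathcomp Require Import all_classical all_reals all_analysis.
Set Implicit Arguments. Unset Strict Implicit. Unset Printing Implicit Defensive.
Import Order.TTheory GRing.Theory Num.Theory.
Import numFieldNormedType.Exports.
Local Open Scope classical_set_scope.
Local Open Scope ring_scope.

Section Defs.
Context {R : realType} {n : nat}.

Notation vec := 'rV[R]_n.

Definition dotv (p q : vec) : R := \sum_(i < n) p 0 i * q 0 i.
Definition enorm (p : vec) : R := Num.sqrt (dotv p p).

Definition eball (x : vec) (r : R) : set vec := [set y | enorm (y - x) < r].

Definition evec (i : 'I_n) : vec := delta_mx 0 i.

(** C^1 on a set D (D open in the uses below): differentiable at each point of
    D, with all directional derivatives (equivalently the partial derivatives)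
    continuous on D. *)
Definition C1_on {V : normedModType R} (D : set V) (phi : V -> R) : Prop :=
  (forall z, D z -> differentiable phi z) /\
  (forall v : V, {within D, continuous (fun z => 'd phi z v)}).

Definition grad (phi : vec -> R) (x : vec) : vec :=
  \row_(i < n) 'd phi x (evec i).

Definition gradx (phi : vec * R -> R) (z : vec * R) : vec :=
  \row_(i < n) 'd phi z (evec i, 0).
Definition dert (phi : vec * R -> R) (z : vec * R) : R := 'd phi z (0, 1).

Definition subdiff (f : vec -> R) (x : vec) : set vec :=
  [set p | exists phi : vec -> R, C1_on setT phi /\
     (\forall y \near x, f x - phi x <= f y - phi y) /\ grad phi x = p].

Definition subdiff2 (u : vec * R -> R) (z : vec * R) : set (vec * R) :=
  [set q | exists phi : vec * R -> R, C1_on setT phi /\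
     (\forall w \near z, u z - phi z <= u w - phi w) /\
     gradx phi z = q.1 /\ dert phi z = q.2].

Definition subdiffx (u : vec * R -> R) (z : vec * R) : set vec :=
  [set p | exists tau, subdiff2 u z (p, tau)].

Definition viscosity_solution (T : R) (H : vec -> R -> R -> vec -> R)
    (u0 : vec -> R) (u : vec * R -> R) : Prop :=
  {within [set z : vec * R | 0 <= z.2 < T], continuous u} /\
  (forall x, u (x, 0) = u0 x) /\
  (forall (phi : vec * R -> R) (z : vec * R),
     C1_on [set w : vec * R | 0 < w.2 < T] phi -> 0 < z.2 < T ->
     ((\forall w \near z, u w - phi w <= u z - phi z) ->
        dert phi z + H z.1 z.2 (u z) (gradx phi z) <= 0) /\
     ((\forall w \near z, u z - phi z <= u w - phi w) ->
        0 <= dert phi z + H z.1 z.2 (u z) (gradx phi z))).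

Definition Rfun (A2 B2 : R) (x : vec) (t : R) : R :=
  if 0 < A2 then (B2 / A2 + enorm x) * (expR (A2 * t) - 1) else B2 * t.

Definition Eset (T A2 B2 : R) (x0 : vec) (r : R) : set (vec * R) :=
  [set z | eball x0 r z.1 /\ 0 < z.2 < T /\
           Rfun A2 B2 z.1 z.2 + enorm (z.1 - x0) < r].

End Defs.

(* Main.v *)
(** For a fixed large [k0] set [w(x, t) = min_y (u(y, t) + k(t) |x - y|^2 + c(t))],
    where [k(t) = k0 exp(- kap t)] with [kap = (beta / 2 + 2) C1 + K3] and
    [4 k c] is the squared bound of the theorem (with [theta] slightly
    decreased).  At time [0] the assumption on the subgradients of [u0] says
    that moving a distance [theta / (2 k0)] lowers [u0] enough to give
    [w <= u].  Since [H] is convex, [u] satisfies the subsolution inequality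
    also at test functions touching it from below (Barron and Jensen), so at a
    minimizing [y] the inequality holds with [p = 2 k (x - y)]; the decay of
    [k] and [c] pays exactly for replacing [y] by [x] and [u(y, t)] by [w], and
    [w] is a subsolution again.  Comparison in a cone of propagation gives
    [w <= u].  If [p] is a spatial subgradient of [u] at [(x, t)], then
    [u(y, t) >= u(x, t) - (|p| + o(1)) |x - y|], and [w(x, t) <= u(x, t)]
    forces [4 k c <= (|p| + o(1))^2].

    Both uses of convexity go through the same computation: moving the base
    point of a sup- or inf-convolution along [(v, 1)], with [v] an approximate
    subgradient of [H] in [p], replaces Danskin's theorem and Rademacher's
    theorem. *)
Require Import Defs.
From HB Require Import structures.
From mathcomp Require Import all_boot all_order all_algebra.
From mathcomp Require Import all_classical all_reals all_analysis.
From mathcomp Require Import ring lra.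
Import Order.TTheory GRing.Theory Num.Theory.
Import numFieldNormedType.Exports.
Local Open Scope classical_set_scope.
Local Open Scope ring_scope.
Set Implicit Arguments. Unset Strict Implicit. Unset Printing Implicit Defensive.

(** * Euclidean norm and compact boxes *)

(** Why the one direction [(v, 1)] suffices: a slope [(p, tau)] enters the equation only through
    [tau + H(p)], and convexity gives [H(p') >= H(p) + v . (p' - p) - e]. To carry the inequality
    from [p'] to [p] it is enough to compare the two slopes along [(v, 1)], and a convolution at two
    nearby base points supplies this comparison through a single extremal point. The constants come
    from Young's inequality. Replacing [y] by [x] at slope [2 k d], [d = |x - y|], costs
    [C1 (beta + 2 k d) d], and [beta d <= beta (k d^2 / 2 + 1 / (2 k))]. The multiples of [k d^2]
    give the exponent [beta / 2 + 2]; the remainder [1 / (2 k)] gives [2 C1 beta t] in [4 k c]. Both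
    [k] and [c] decay at rate [K3] for (H3), hence [2 K3] in the product. Two obstacles shape the
    rest. [H] is merely continuous in time, so the doubling of variables needs slopes bounded in
    advance; this is why the inf-convolution is also made Lipschitz in time. And [u] has no growth
    bound, so every convolution is taken over a compact box. *)

Section Euclid.
Context {R : realType} {n : nat}.
Notation V := 'rV[R]_n.
Implicit Types (x y p q : V) (a : R).

Lemma dotvC x y : dotv x y = dotv y x.
Proof. by apply: eq_bigr => i _; rewrite mulrC. Qed.

Lemma dotvDl x y z : dotv (x + y) z = dotv x z + dotv y z.
Proof. by rewrite -big_split; apply: eq_bigr => i _; rewrite mxE mulrDl. Qed.

Lemma dotvZl a x y : dotv (a *: x) y = a * dotv x y.
Proof. by rewrite mulr_sumr; apply: eq_bigr => i _; rewrite mxE mulrA. Qed.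

Lemma dotvDr x y z : dotv x (y + z) = dotv x y + dotv x z.
Proof. by rewrite dotvC dotvDl ![dotv _ x]dotvC. Qed.

Lemma dotvZr a x y : dotv x (a *: y) = a * dotv x y.
Proof. by rewrite dotvC dotvZl dotvC. Qed.

Lemma dotvNl x y : dotv (- x) y = - dotv x y.
Proof. by rewrite -scaleN1r dotvZl mulN1r. Qed.

Lemma dotvNr x y : dotv x (- y) = - dotv x y.
Proof. by rewrite dotvC dotvNl dotvC. Qed.

Definition dotvE := (dotvDl, dotvDr, dotvNl, dotvNr, dotvZl, dotvZr).

Lemma dotv0l x : dotv 0 x = 0.
Proof. by rewrite -(scale0r 0) dotvZl mul0r. Qed.

Lemma dotv_ge0 x : 0 <= dotv x x.
Proof. by apply: sumr_ge0 => i _; rewrite -expr2 sqr_ge0. Qed.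

Lemma enorm_ge0 x : 0 <= enorm x.
Proof. exact: sqrtr_ge0. Qed.

Lemma enorm_sqr x : enorm x ^+ 2 = dotv x x.
Proof. by rewrite sqr_sqrtr ?dotv_ge0. Qed.

Lemma enorm0 : enorm (0 : V) = 0.
Proof. by rewrite /enorm dotv0l sqrtr0. Qed.

Lemma enormZ a x : enorm (a *: x) = `|a| * enorm x.
Proof.
by rewrite /enorm dotvZl dotvZr mulrA -expr2 sqrtrM ?sqr_ge0// sqrtr_sqr.
Qed.

Lemma enormN x : enorm (- x) = enorm x.
Proof. by rewrite -scaleN1r enormZ normrN1 mul1r. Qed.

Lemma enormB x y : enorm (x - y) = enorm (y - x).
Proof. by rewrite -enormN opprB. Qed.

(** Cauchy-Schwarz, from the square of [(y . y) x - (x . y) y]. If [y . y = 0], the square of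
    [x + a y] is affine in [a] and bounded below, so its slope vanishes. *)
Lemma dotv_sqr_le x y : dotv x y ^+ 2 <= dotv x x * dotv y y.
Proof.
have [y0|y0] := eqVneq (dotv y y) 0.
  have h a : 0 <= dotv x x + a * (2 * dotv x y).
    by have := dotv_ge0 (x + a *: y); rewrite !dotvE y0 (dotvC y x); lra.
  suff -> : dotv x y = 0 by rewrite expr0n/= mulr_ge0 ?dotv_ge0.
  apply/eqP; apply: contraT => xy0; have := h (- (dotv x x + 1) / (2 * dotv x y)).
  by rewrite divfK ?mulf_neq0//; lra.
have yp : 0 < dotv y y by rewrite lt_neqAle eq_sym y0 dotv_ge0.
have := dotv_ge0 (dotv y y *: x - dotv x y *: y).
rewrite !dotvE (dotvC y x) => h.
have : 0 <= dotv y y * (dotv x x * dotv y y - dotv x y ^+ 2).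
  by apply: le_trans h _; rewrite le_eqVlt; apply/orP; left; apply/eqP; ring.
by rewrite pmulr_rge0// subr_ge0.
Qed.

Lemma dotv_le x y : `|dotv x y| <= enorm x * enorm y.
Proof.
by rewrite -sqrtr_sqr -sqrtrM ?dotv_ge0// ler_wsqrtr// dotv_sqr_le.
Qed.

Lemma ler_enormD x y : enorm (x + y) <= enorm x + enorm y.
Proof.
rewrite -ler_sqr ?nnegrE ?addr_ge0 ?enorm_ge0// enorm_sqr !dotvE (dotvC y x).
rewrite sqrrD !enorm_sqr.
by have := dotv_le x y; rewrite ler_norml => /andP[_]; lra.
Qed.

Lemma ler_enorm_dist x y z : enorm (x - z) <= enorm (x - y) + enorm (y - z).
Proof. by rewrite (le_trans _ (ler_enormD _ _))// addrA subrK. Qed.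

Lemma ler_dist_enorm x y : `|enorm x - enorm y| <= enorm (x - y).
Proof.
have := ler_enormD (x - y) y; rewrite subrK => h1.
have := ler_enormD (y - x) x; rewrite subrK enormB => h2.
by rewrite ler_norml; apply/andP; split; lra.
Qed.

(** The norm carried by the type of row vectors is the sup norm; together with [norm_enorm] this
    identifies its topology with the Euclidean one. *)
Lemma enorm_norm x : `|x| <= enorm x.
Proof.
rewrite [leLHS]/Num.Def.normr/= mx_normrE; apply/bigmax_leP; split => [|[i j] _ /=].
  exact: enorm_ge0.
rewrite (ord1 i) -ler_sqr ?nnegrE ?enorm_ge0// enorm_sqr real_normK ?num_real//.
rewrite /dotv (bigD1 j)//= -expr2 lerDl sumr_ge0// => k _.
by rewrite -expr2 sqr_ge0.
Qed.

Lemma coord_norm x i : `|x 0 i| <= `|x|.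
Proof.
rewrite [leRHS]/Num.Def.normr/= mx_normrE.
by apply/bigmax_geP; right => /=; exists (0, i).
Qed.

Lemma norm_enorm x : enorm x <= n%:R * `|x|.
Proof.
rewrite -ler_sqr ?nnegrE ?enorm_ge0 ?mulr_ge0// enorm_sqr exprMn.
apply: le_trans (_ : \sum_(i < n) `|x| ^+ 2 <= _).
  apply: ler_sum => i _; rewrite -expr2 -(@real_normK _ (x 0 i)) ?num_real//.
  by rewrite ler_sqr ?nnegrE// coord_norm.
rewrite sumr_const card_ord -[leLHS]mulr_natl ler_wpM2r ?sqr_ge0//.
by rewrite -natrX ler_nat; case: (n) => // k; rewrite leq_pmulr.
Qed.

Lemma continuous_distP {E : normedModType R} (g : E -> R) :
  (forall (x : E) (e : R), 0 < e ->
    exists2 d : R, 0 < d & forall y : E, `|x - y| < d -> `|g x - g y| < e) ->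
  continuous g.
Proof.
move=> h x; apply/(@cvgrPdist_lt _ _ _ (nbhs x) (nbhs_filter x)) => e e0.
have [d d0 xd] := h x e e0.
by apply/nbhs_ballP; exists d => // y; rewrite -ball_normE; exact: xd.
Qed.

Lemma enorm_dist (x : V) (e : R) : 0 < e ->
  exists2 d : R, 0 < d & forall y, `|x - y| < d -> `|enorm x - enorm y| < e.
Proof.
move=> e0; have n1 : 0 < n%:R + 1 :> R by rewrite ltr_wpDl.
exists ((n%:R + 1)^-1 * e); first by rewrite mulr_gt0 ?invr_gt0.
move=> y xy.
apply: le_lt_trans (ler_dist_enorm _ _) _.
apply: le_lt_trans (norm_enorm _) _.
apply: le_lt_trans (_ : (n%:R + 1) * `|x - y| < _).
  by rewrite mulrDl mul1r lerDl.
by rewrite -ltr_pdivlMl.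
Qed.

Lemma enorm_continuous : continuous (enorm : V -> R).
Proof. by apply: continuous_distP => x e e0; exact: enorm_dist. Qed.

Lemma eball_compact (a : V) rho : compact [set x : V | enorm (x - a) <= rho].
Proof.
apply: bounded_closed_compact.
  exists (rho + enorm a); split; first exact: num_real.
  move=> M M0 x /= xa; apply: le_trans (enorm_norm _) _.
  by have := ler_enormD (x - a) a; rewrite subrK => h; lra.
have ac : continuous (fun x : V => enorm (x - a)).
  apply: continuous_distP => x e e0.
  have [d d0 h] := enorm_dist (x - a) e0.
  exists d => // y xy; apply: h.
  by rewrite opprB addrA subrK.
exact: (closed_comp (fun x _ => ac x) (@closed_le _ rho)).
Qed.

Definition box (a : V) (rho t1 t2 : R) : set (V * R) :=
  [set z | enorm (z.1 - a) <= rho /\ t1 <= z.2 <= t2].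

Lemma box_compact (a : V) rho t1 t2 : compact (box a rho t1 t2).
Proof.
have -> : box a rho t1 t2 = [set x | enorm (x - a) <= rho] `*` `[t1, t2]%classic.
  by apply/seteqP; split => -[x t]; rewrite /= in_itv/=.
by apply: compact_setX; [exact: eball_compact | exact: segment_compact].
Qed.

Lemma norm_pair_lt {E F : normedModType R} (z : E * F) d :
  `|z.1| < d -> `|z.2| < d -> `|z| < d.
Proof. by move=> h1 h2; rewrite /Num.Def.normr/= gt_max h1. Qed.

(** Since [g] is continuous on the whole space, only the first point has to lie in [K]; the covering
    argument then never asks where [w] is. *)
Lemma compact_unif_continuous {E : normedModType R} (K : set E) (g : E -> R) :
  compact K -> continuous g -> forall e : R, 0 < e ->
  exists2 d : R, 0 < d & forall z w : E, K z -> `|z - w| < d -> `|g z - g w| < e.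
Proof.
move=> /compact_near_coveringP Kc gc e e0.
have /= := Kc R (0^'+) (fun d z => forall w, `|z - w| < d -> `|g z - g w| < e) _.
move=> /(_ _)[].
  move=> z Kz.
  have ltr02 : 0 < 2 :> R by [].
  have /cvgrPdist_lt/(_ (e / 2)) : g @ z --> g z by exact: gc.
  move=> /(_ (divr_gt0 e0 ltr02))/nbhs_ballP[d /= d0 dz].
  exists (ball z (d / 2), [set d' | 0 < d' < d / 2]) => /=.
    split; first by apply: nbhsx_ballx; rewrite divr_gt0.
    near=> d'; apply/andP; split; near: d'; first exact: nbhs_right_gt.
    by apply: nbhs_right_lt; rewrite divr_gt0.
  move=> [z' d'] /= [zz' /andP[d'0 d'd]] w z'w.
  rewrite -ball_normE/= in zz' dz.
  have h1 : `|g z - g z'| < e / 2.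
    apply: (dz z'); apply: lt_trans zz' _.
    by rewrite ltr_pdivrMr// ltr_pMr// ltr1n.
  have h2 : `|g z - g w| < e / 2.
    apply: (dz w); rewrite /ball_/=; apply: le_lt_trans (ler_distD z' _ _) _.
    by rewrite (splitr d) ltrD// (lt_trans z'w).
  apply: le_lt_trans (ler_distD (g z) _ _) _.
  by rewrite (splitr e) ltrD// distrC.
move=> d /= d0 h; exists (d / 2); first by rewrite divr_gt0.
move=> z w Kz; apply: h => //=; last by rewrite divr_gt0.
by rewrite sub0r normrN gtr0_norm ?divr_gt0//; lra.
Unshelve. all: by end_near. Qed.

Lemma box_unif_continuous (a : V) rho t1 t2 (g : V * R -> R) : continuous g ->
  forall e : R, 0 < e -> exists2 d : R, 0 < d & forall z w : V * R, box a rho t1 t2 z ->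
    enorm (z.1 - w.1) < d -> `|z.2 - w.2| < d -> `|g z - g w| < e.
Proof.
move=> gc e e0.
have [d d0 h] := compact_unif_continuous (@box_compact a rho t1 t2) gc e0.
exists d => // z w Kz zw1 zw2; apply: h => //; apply: norm_pair_lt => //.
by apply: le_lt_trans zw1; exact: enorm_norm.
Qed.

Lemma box_bounded (a : V) rho t1 t2 (g : V * R -> R) : continuous g ->
  exists2 C : R, 0 < C & forall z, box a rho t1 t2 z -> `|g z| <= C.
Proof.
move=> gc.
have [->|K0] := eqVneq (box a rho t1 t2) set0; first by exists 1.
have gc' : continuous (fun z => `|g z|).
  by move=> z; apply: continuous_comp (gc z) _; exact: norm_continuous.
have [c _ h] := compact_EVT_max ((set0P _).1 K0)
  (@box_compact a rho t1 t2) (continuous_subspaceT gc').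
exists (`|g c| + 1); first by rewrite ltr_wpDl.
by move=> z Kz; rewrite (le_trans (h z _)) ?inE// lerDl.
Qed.

(** The structural hypotheses give no modulus in [t], so compactness is the only source of one; it
    therefore depends on bounds for position, value and slope. *)
Lemma hamiltonian_unif_time (H : V -> R -> R -> V -> R) (a : V) rho t1 t2 C P :
  continuous (fun w : V * R * R * V => H w.1.1.1 w.1.1.2 w.1.2 w.2) ->
  forall e : R, 0 < e ->
  exists2 d : R, 0 < d & forall x t s v p, box a rho t1 t2 (x, t) ->
    `|v| <= C -> enorm p <= P -> `|t - s| < d -> `|H x t v p - H x s v p| < e.
Proof.
move=> Hc e e0.
have Kc : compact (box a rho t1 t2 `*` `[- C, C]%classic `*`
    [set p : V | enorm (p - 0) <= P]).
  apply: compact_setX; last exact: eball_compact.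
  by apply: compact_setX; [exact: box_compact | exact: segment_compact].
have [d d0 h] := compact_unif_continuous Kc Hc e0.
exists d => // x t s v p Kx vC pP ts.
apply: (h (x, t, v, p) (x, s, v, p)).
  by split => //=; [split => //=; rewrite in_itv/= -ler_norml | rewrite subr0].
by do ?[apply: norm_pair_lt => /=]; rewrite ?subrr ?normr0.
Qed.

End Euclid.

(** * Functions with a given continuous differential *)

Lemma is_diff_coord (K : numFieldType) m n (M : 'M[K]_(m, n)) i j :
  is_diff M (fun N : 'M[K]_(m, n) => N i j : K) (fun N => N i j).
Proof.
have @f : {linear 'M[K]_(m, n) -> K}.
  by exists (fun N : 'M[K]_(_, _) => N i j); do 2![eexists]; do ?[constructor];
     rewrite ?mxE// => ? *; rewrite ?mxE//; move=> ?; rewrite !mxE.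
have fc : continuous f by exact: coord_continuous.
have := diff_lin M fc; have := linear_differentiable M fc.
by split.
Qed.

Section C1.
Context {R : realType}.

(** The differential is carried as an explicit formula [df], so that gradients of composite test
    functions are read off instead of computed from ['d]. *)
Definition C1w {E : normedModType R} (f : E -> R) (df : E -> E -> R) :=
  (forall z, is_diff z f (df z)) /\ (forall v, continuous (fun z => df z v)).

Lemma C1w_ext {E : normedModType R} (f g : E -> R) (df dg : E -> E -> R) :
  C1w f df -> f =1 g -> (forall z v, df z v = dg z v) -> C1w g dg.
Proof.
move=> h /funext <- e; rewrite (_ : dg = df)//.
by apply/funext => z; apply/funext => v; rewrite e.
Qed.

Section closure.
Context {E : normedModType R}.
Implicit Types (f g : E -> R) (df dg : E -> E -> R).

Lemma C1w_diffE f df z v : C1w f df -> 'd f z v = df z v.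
Proof. by move=> [fd _]; have -> : 'd f z = df z :> (E -> R) by apply: diff_val. Qed.

Lemma C1w_continuous f df : C1w f df -> continuous f.
Proof. by move=> [fd _] z; apply: differentiable_continuous. Qed.

Lemma C1w_C1_on f df (D : set E) : C1w f df -> C1_on D f.
Proof.
move=> h; split => [z _|v]; first by have [fd _] := h.
apply: continuous_subspaceT.
rewrite (_ : (fun _ => _) = fun z => df z v); first exact: h.2.
by apply/funext => z; exact: C1w_diffE.
Qed.

Lemma C1w_cst (a : R) : C1w (fun _ : E => a) (fun _ _ => 0).
Proof.
split => [z|v]; last by move=> z; exact: cvg_cst.
exact: is_diff_cst.
Qed.

Lemma C1w_add f g df dg : C1w f df -> C1w g dg ->
  C1w (fun z => f z + g z) (fun z v => df z v + dg z v).
Proof.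
move=> [fd fc] [gd gc]; split => [z|v z]; last exact: (cvgD (fc v z) (gc v z)).
exact: is_diffD.
Qed.

Lemma C1w_mul f g df dg : C1w f df -> C1w g dg ->
  C1w (fun z => f z * g z) (fun z v => f z * dg z v + g z * df z v).
Proof.
move=> hf hg; have [fd fc] := hf; have [gd gc] := hg; split => [z|v z].
  exact: is_diffM.
by apply: cvgD; apply: cvgM; [exact: (C1w_continuous hf)|exact: gc|
  exact: (C1w_continuous hg)|exact: fc].
Qed.

Lemma C1w_scale (a : R) f df : C1w f df ->
  C1w (fun z => a * f z) (fun z v => a * df z v).
Proof.
move=> [fd fc]; split => [z|v z]; first exact: is_diffZ.
by apply: cvgM; [exact: cvg_cst|exact: fc].
Qed.

Lemma C1w_comp f df (g g' : R -> R) : C1w f df ->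
  (forall z, is_derive (f z) 1 g (g' (f z))) ->
  (forall z, {for f z, continuous g'}) ->
  C1w (fun z => g (f z)) (fun z v => g' (f z) * df z v).
Proof.
move=> hf hg gc; have [fd fc] := hf; split => [z|v z].
  have gd : is_diff (f z) g (fun h => h * g' (f z)).
    have hgz := hg z; split; first by apply/derivable1_diffP.
    apply/funext => h; rewrite diff1E; first by rewrite derive1E derive_val.
    exact/derivable1_diffP.
  apply: is_diff_eq (is_diff_comp (fd z) gd) _.
  by apply/funext => h /=; rewrite mulrC.
apply: cvgM; last exact: fc.
apply: (cvg_comp f g'); last exact: (gc z).
exact: (C1w_continuous hf).
Qed.

Lemma C1w_sum n (f : 'I_n -> E -> R) (df : 'I_n -> E -> E -> R) :
  (forall i, C1w (f i) (df i)) ->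
  C1w (fun z => \sum_i f i z) (fun z v => \sum_i df i z v).
Proof.
elim: n f df => [|n ih] f df h.
  by apply: C1w_ext (C1w_cst 0) _ _ => [z|z v]; rewrite big_ord0.
apply: C1w_ext (C1w_add (h ord0) (ih _ _ (fun i => h (lift ord0 i)))) _ _.
  by move=> z; rewrite big_ord_recl.
by move=> z v; rewrite big_ord_recl.
Qed.

End closure.

Lemma C1w_fst {E F : normedModType R} f df : C1w f df ->
  C1w (fun z : E * F => f z.1) (fun z v => df z.1 v.1).
Proof.
move=> [fd fc]; split => [z|v z].
  have fstd : is_diff z (fst : E * F -> E) fst.
    have c : continuous (fst : E * F -> E) by move=> w; exact: cvg_fst.
    by split; [exact: linear_differentiable | rewrite diff_lin].
  exact: (is_diff_comp fstd (fd z.1)).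
apply: (cvg_comp (fst : E * F -> E) (fun x => df x v.1)); first exact: cvg_fst.
exact: fc.
Qed.

Lemma C1w_snd {E : normedModType R} :
  C1w (fun z : E * R => z.2) (fun z v => v.2).
Proof.
split => [z|v z]; last exact: cvg_cst.
have c : continuous (snd : E * R -> R) by move=> w; exact: cvg_snd.
by split; [exact: linear_differentiable | rewrite diff_lin].
Qed.

Lemma C1w_coord {n : nat} (i : 'I_n) :
  C1w (fun y : 'rV[R]_n => y 0 i) (fun _ v => v 0 i).
Proof. by split => [z|v]; [exact: is_diff_coord | exact: cst_continuous]. Qed.

Lemma C1w_sq {n : nat} (a : 'rV[R]_n) :
  C1w (fun y : 'rV[R]_n => dotv (y - a) (y - a)) (fun y v => 2 * dotv (y - a) v).
Proof.
pose f (i : 'I_n) (y : 'rV[R]_n) := (y 0 i - a 0 i).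
have h i : C1w (f i) (fun _ v => v 0 i).
  apply: C1w_ext (C1w_add (C1w_coord i) (C1w_cst (- a 0 i))) _ _ => // z v.
  by rewrite addr0.
apply: C1w_ext (C1w_sum (fun i => C1w_mul (h i) (h i))) _ _ => [z|z v].
  by apply: eq_bigr => i _; rewrite !mxE.
rewrite /dotv mulr_sumr; apply: eq_bigr => i _.
by rewrite !mxE /f; ring.
Qed.

End C1.

(** * Minimization and approximate subgradients *)

Section Minimization.
Context {R : realType}.

Lemma cont_cst {E : topologicalType} (a : R) : continuous (fun _ : E => a).
Proof. by move=> z; exact: cvg_cst. Qed.

Lemma contD {E : topologicalType} (f g : E -> R) :
  continuous f -> continuous g -> continuous (fun z => f z + g z).
Proof. by move=> fc gc z; apply: cvgD; [exact: fc | exact: gc]. Qed.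

Lemma contN {E : topologicalType} (f : E -> R) :
  continuous f -> continuous (fun z => - f z).
Proof. by move=> fc z; apply: cvgN; exact: fc. Qed.

Lemma contM {E : topologicalType} (f g : E -> R) :
  continuous f -> continuous g -> continuous (fun z => f z * g z).
Proof. by move=> fc gc z; apply: cvgM; [exact: fc | exact: gc]. Qed.

Lemma cont_comp {E F G : topologicalType} (f : E -> F) (g : F -> G) :
  continuous f -> continuous g -> continuous (fun z => g (f z)).
Proof.
move=> fc gc z; apply: (cvg_comp f g); last exact: gc.
exact: fc.
Qed.

Lemma cont_pair {E F G : topologicalType} (f : E -> F) (g : E -> G) :
  continuous f -> continuous g -> continuous (fun z => (f z, g z)).
Proof.
move=> fc gc z; apply: cvg_pair; first exact: fc.
exact: gc.
Qed.

Lemma cont_sum {E : topologicalType} m (f : 'I_m -> E -> R) :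
  (forall i, continuous (f i)) -> continuous (fun z => \sum_i f i z).
Proof.
elim: m f => [|m ih] f fc.
  by under eq_fun do rewrite big_ord0; exact: cont_cst.
by under eq_fun do rewrite big_ord_recl; apply: contD; [exact: fc | exact: ih].
Qed.

Lemma compact_argmin {E : topologicalType} (K : set E) (g : E -> R) :
  K !=set0 -> compact K -> continuous g ->
  exists2 c, K c & forall t, K t -> g c <= g t.
Proof.
move=> K0 Kc gc.
have [c cK h] := compact_EVT_min K0 Kc (continuous_subspaceT gc).
by exists c => [|t Kt]; [rewrite inE in cK | rewrite h// inE].
Qed.

Lemma compact_argmax {E : topologicalType} (K : set E) (g : E -> R) :
  K !=set0 -> compact K -> continuous g ->
  exists2 c, K c & forall t, K t -> g t <= g c.
Proof.
move=> K0 Kc gc.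
have [c cK h] := compact_EVT_max K0 Kc (continuous_subspaceT gc).
by exists c => [|t Kt]; [rewrite inE in cK | rewrite h// inE].
Qed.

(** Stands for the limit [l -> 0] in first-order arguments: all errors of order [l] are collected in
    [B]. *)
Lemma le0_of_small (A B l0 : R) : 0 < l0 ->
  (forall l, 0 < l <= l0 -> A <= l * B) -> A <= 0.
Proof.
move=> l00 h; rewrite leNgt; apply/negP => A0.
have B1 : 0 < `|B| + 1 by rewrite ltr_wpDl.
pose l := Num.min l0 (A / 2 / (`|B| + 1)).
have lp : 0 < l by rewrite lt_min l00 !divr_gt0.
have := h l; rewrite lp /l ge_min lexx -/l => /(_ isT) h1.
have h2 : l * B <= l * (`|B| + 1).
  by rewrite ler_pM2l//; have := ler_norm B; lra.
have h3 : l * (`|B| + 1) <= A / 2.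
  by rewrite -ler_pdivlMr// /l ge_min lexx orbT.
by lra.
Qed.

Section Convex.
Context {n : nat}.
Notation V := 'rV[R]_n.

Lemma lipschitz_continuous_enorm (h : V -> R) (L : R) :
  (forall x y, `|h x - h y| <= L * enorm (x - y)) -> continuous h.
Proof.
move=> hL; apply: continuous_distP => x e e0.
have n1 : 0 < n%:R + 1 :> R by rewrite ltr_wpDl.
have L1 : 0 < `|L| + 1 by rewrite ltr_wpDl.
exists (e / (`|L| + 1) / (n%:R + 1)) => [|y]; first by rewrite !divr_gt0.
rewrite !ltr_pdivlMr// => xy; apply: le_lt_trans (hL _ _) _.
apply: le_lt_trans xy; rewrite mulrC.
apply: le_trans (_ : enorm (x - y) * (`|L| + 1) <= _).
  by rewrite ler_wpM2l ?enorm_ge0//; have := ler_norm L; lra.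
rewrite ler_wpM2r ?(ltW L1)//.
apply: le_trans (norm_enorm _) _; rewrite mulrC ler_wpM2l//.
by rewrite lerDl.
Qed.

Definition sqd (x y : V) : R := dotv (x - y) (x - y).

Lemma sqdC x y : sqd x y = sqd y x.
Proof. by rewrite /sqd -(opprB y x) dotvNl dotvNr opprK. Qed.

Lemma sqdE x y : sqd x y = enorm (x - y) ^+ 2.
Proof. by rewrite enorm_sqr. Qed.

Lemma sqd_ge0 x y : 0 <= sqd x y.
Proof. exact: dotv_ge0. Qed.

Lemma sqdxx x : sqd x x = 0.
Proof. by rewrite /sqd subrr dotv0l. Qed.

Lemma sqdD x y v (h : R) :
  sqd (x + h *: v) y = sqd x y + 2 * h * dotv v (x - y) + h ^+ 2 * dotv v v.
Proof. by rewrite /sqd addrAC !dotvE (dotvC x v) (dotvC y v); ring. Qed.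

Lemma sqd_continuous y : continuous (fun x => sqd x y).
Proof. exact: C1w_continuous (C1w_sq y). Qed.

(** A minimizer [q0] of [f + N |. - p|^2] lies near [p], and by convexity [2 N (p - q0)] is an exact
    subgradient at [q0]. Moving it back to [p] costs at most [L |p - q0|]. *)
Lemma convex_approx_subgradient (f : V -> R) (L : R) :
  (forall p q, `|f p - f q| <= L * enorm (p - q)) ->
  (forall p q (l : R), 0 <= l <= 1 ->
     f (l *: p + (1 - l) *: q) <= l * f p + (1 - l) * f q) ->
  forall p e, 0 < e -> exists v, forall q, f p + dotv v (q - p) - e <= f q.
Proof.
move=> fL fcvx p e e0.
have fc := lipschitz_continuous_enorm fL.
pose l := `|L|.
have l0 : 0 <= l by exact: normr_ge0.
have fl x y : `|f x - f y| <= l * enorm (x - y).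
  by rewrite (le_trans (fL _ _))// ler_wpM2r ?enorm_ge0// ler_norm.
(* Minimality gives [N d <= l] for the distance [d] of the minimizer from [p]. Thus [N > l] puts it
   inside the unit ball, and [N >= l^2 / e] makes the error [l d] at most [e]. *)
pose N := l ^+ 2 / e + l + 1.
have le0 : 0 <= l ^+ 2 / e by rewrite divr_ge0 ?sqr_ge0// ltW.
have N0 : 0 < N by rewrite /N; lra.
pose g q := f q + N * sqd q p.
have gc : continuous g.
  exact: (contD fc (contM (@cont_cst _ N) (@sqd_continuous p))).
have [||q0 /= q0p q0min] := @compact_argmin _ [set q | enorm (q - p) <= 1] g _ _ gc.
- by exists p; rewrite /= subrr enorm0.
- exact: eball_compact.
pose d := enorm (q0 - p).
have d0 : 0 <= d by exact: enorm_ge0.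
have Nd : N * d ^+ 2 <= l * d.
  have := q0min p; rewrite /= subrr enorm0 ler01 => /(_ isT).
  rewrite /g sqdxx sqdE -/d => h1.
  have := fl p q0; rewrite enormB -/d ler_norml => /andP[_ h2].
  by lra.
have Nd' : N * d <= l.
  have [->|dn0] := eqVneq d 0; first by rewrite mulr0.
  have dp : 0 < d by rewrite lt_neqAle eq_sym dn0.
  by rewrite -(ler_pM2r dp) -mulrA -expr2.
have d1 : d < 1.
  rewrite -(ltr_pM2l N0) mulr1; apply: le_lt_trans Nd' _.
  by rewrite /N; lra.
have ld : l * d <= e.
  rewrite -(ler_pM2l N0); apply: (@le_trans _ _ (l ^+ 2)).
    by rewrite mulrCA expr2 ler_wpM2l.
  have -> : N * e = l ^+ 2 + (l + 1) * e by rewrite /N; field; rewrite gt_eqF.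
  by rewrite lerDl mulr_ge0 ?ltW//; lra.
exists ((2 * N) *: (p - q0)) => q.
have key : f q0 - f q - 2 * N * dotv (q0 - p) (q - q0) <= 0.
  have r0 : 0 <= enorm (q - q0) by exact: enorm_ge0.
  have r1 : 0 < enorm (q - q0) + 1 by lra.
  have md : 0 < 1 - d by lra.
  apply: (@le0_of_small _ (N * dotv (q - q0) (q - q0))
    ((1 - d) / (enorm (q - q0) + 1))); first by rewrite divr_gt0.
  move=> t /andP[t0]; rewrite ler_pdivlMr// mulrDr mulr1 => tle.
  have tr0 : 0 <= t * enorm (q - q0) by rewrite mulr_ge0// ltW.
  have tq : enorm (q0 + t *: (q - q0) - p) <= 1.
    rewrite addrAC; apply: le_trans (ler_enormD _ _) _.
    by rewrite -/d enormZ gtr0_norm//; lra.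
  have := q0min _ tq; rewrite /g sqdD => h1.
  have t01 : 0 <= t <= 1 by rewrite ltW//=; lra.
  have := fcvx q q0 t t01.
  have -> : t *: q + (1 - t) *: q0 = q0 + t *: (q - q0).
    by rewrite scalerBl scale1r scalerBr addrCA.
  rewrite (dotvC (q - q0) (q0 - p)) in h1 => h2.
  rewrite -(ler_pM2l t0); move: h1 h2.
  set A := dotv _ _; set B := dotv _ _ => h1 h2.
  have -> : t * (t * (N * B)) = N * (t ^+ 2 * B) by ring.
  by lra.
have := fl p q0; rewrite enormB -/d ler_norml => /andP[_ h2].
have : dotv ((2 * N) *: (p - q0)) (q - p) <= - (2 * N * dotv (q0 - p) (q - q0)).
  have -> : q - p = (q - q0) + (q0 - p) by rewrite addrA subrK.
  rewrite -(opprB q0 p) dotvZl dotvNl dotvDr.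
  have : 0 <= N * dotv (q0 - p) (q0 - p) by rewrite mulr_ge0 ?(ltW N0) ?dotv_ge0.
  by lra.
lra.
Qed.

End Convex.
End Minimization.

(** * Inf-convolution *)

Section InfConvolution.
Context {R : realType} {n : nat}.
Notation V := 'rV[R]_n.
Notation E := (V * R)%type.

(** The weight [a] is taken at the competing point [S], not at the base point [Q]. For fixed [S] the
    penalty is therefore a quadratic polynomial in [Q], with exact second-order expansion, while the
    derivative of [a] appears only in the test function at [S]. *)
Definition qpen (a : E -> R) (b : R) (Q S : E) : R :=
  a S * sqd S.1 Q.1 + b * (S.2 - Q.2) ^+ 2.

Lemma infconv_argmin (K : set E) (G a : E -> R) (b : R) :
  K !=set0 -> compact K -> continuous G -> continuous a ->
  exists sel : E -> E, forall Q, K (sel Q) /\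
    forall S, K S -> G (sel Q) + qpen a b Q (sel Q) <= G S + qpen a b Q S.
Proof.
move=> K0 Kc Gc ac.
suff /choice[sel h] : forall Q, exists S0, K S0 /\
    forall S, K S -> G S0 + qpen a b Q S0 <= G S + qpen a b Q S.
  by exists sel.
move=> Q.
have c1 : continuous (fun S : E => sqd S.1 Q.1).
  exact: C1w_continuous (C1w_fst (C1w_sq Q.1)).
have c2 : continuous (fun S : E => S.2 - Q.2).
  exact: C1w_continuous (C1w_add C1w_snd (C1w_cst (- Q.2))).
have c : continuous (fun S => G S + qpen a b Q S).
  apply: contD => //; apply: contD; first exact: contM.
  by apply: contM; [exact: cont_cst | exact: contM].
by have [S0 KS0 h] := compact_argmin K0 Kc c; exists S0.
Qed.

Lemma sqd_dist (c s x x' : V) rho rho' : enorm (s - c) <= rho ->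
  enorm (x - c) <= rho' -> enorm (x' - c) <= rho' ->
  sqd s x - sqd s x' <= 2 * (rho + rho') * enorm (x - x').
Proof.
move=> hs hx hx'.
have -> : sqd s x - sqd s x' = dotv (x' - x) ((s - x) + (s - x')).
  rewrite /sqd; have -> : s - x' = (s - x) + (x - x') by rewrite addrA subrK.
  rewrite -(opprB x x').
  by move: (s - x) (x - x') => a b; rewrite !dotvE (dotvC b a); ring.
have le1 y : enorm (y - c) <= rho' -> enorm (s - y) <= rho + rho'.
  by move=> hy; have := ler_enorm_dist s c y; rewrite (enormB c y); lra.
apply: le_trans (ler_norm _) _; apply: le_trans (dotv_le _ _) _.
rewrite mulrC (enormB x') ler_wpM2r ?enorm_ge0//.
apply: le_trans (ler_enormD _ _) _.
by have := le1 _ hx; have := le1 _ hx'; lra.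
Qed.

Lemma sqr_dist (s t t' M : R) : `|s - t| <= M -> `|s - t'| <= M ->
  (s - t) ^+ 2 - (s - t') ^+ 2 <= 2 * M * `|t - t'|.
Proof.
move=> h h'.
have -> : (s - t) ^+ 2 - (s - t') ^+ 2 = (t' - t) * ((s - t) + (s - t')) by ring.
apply: le_trans (ler_norm _) _; rewrite normrM mulrC (distrC t').
apply: ler_wpM2r => //.
by apply: le_trans (ler_normD _ _) _; lra.
Qed.

(** The minimizer at [Q'] is a competitor at [Q], so the two values differ by at most a change of
    penalty, which is Lipschitz in the base point on bounded sets. *)
Lemma infconv_lipschitz (K : set E) (G a : E -> R) (b A : R) (sel : E -> E)
    (c : V) rho t1 t2 rho' s1 s2 :
  (forall Q, K (sel Q) /\
    forall S, K S -> G (sel Q) + qpen a b Q (sel Q) <= G S + qpen a b Q S) ->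
  (forall S, K S -> box c rho t1 t2 S) ->
  (forall S, K S -> 0 <= a S <= A) -> 0 <= b ->
  exists2 L, 0 < L & forall Q Q', box c rho' s1 s2 Q -> box c rho' s1 s2 Q' ->
    `|(G (sel Q) + qpen a b Q (sel Q)) - (G (sel Q') + qpen a b Q' (sel Q'))|
      <= L * (enorm (Q.1 - Q'.1) + `|Q.2 - Q'.2|).
Proof.
move=> hsel Kbox aA b0.
pose M := `|t1| + `|t2| + `|s1| + `|s2|.
have M0 : 0 <= M by rewrite !addr_ge0.
pose L := `|A| * (2 * (`|rho| + `|rho'|)) + b * (2 * M) + 1.
have L1 : 0 <= `|A| * (2 * (`|rho| + `|rho'|)) by rewrite !mulr_ge0 ?addr_ge0.
have L2 : 0 <= b * (2 * M) by rewrite !mulr_ge0.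
exists L; first by rewrite /L; lra.
have half Q Q' : box c rho' s1 s2 Q -> box c rho' s1 s2 Q' ->
    G (sel Q) + qpen a b Q (sel Q) - (G (sel Q') + qpen a b Q' (sel Q')) <=
      L * (enorm (Q.1 - Q'.1) + `|Q.2 - Q'.2|).
  move=> [Q1 /andP[Q2 Q3]] [Q1' /andP[Q2' Q3']].
  have [KS _] := hsel Q'; have [_ /(_ _ KS)] := hsel Q.
  have [S1 /andP[S2 S3]] := Kbox _ KS; have /andP[a0 a1] := aA _ KS.
  rewrite /qpen; move: (sel Q') KS S1 S2 S3 a0 a1 => S KS S1 S2 S3 a0 a1 h.
  have r0 : 0 <= rho by apply: le_trans S1; exact: enorm_ge0.
  have r0' : 0 <= rho' by apply: le_trans Q1; exact: enorm_ge0.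
  have A0 : 0 <= A by lra.
  have h1 := sqd_dist S1 Q1 Q1'.
  have time t : s1 <= t <= s2 -> `|S.2 - t| <= M.
    move=> /andP[tt1 tt2]; rewrite /M ler_norml.
    have := ler_norm t1; have := ler_norm t2; have := ler_norm s1; have := ler_norm s2.
    have := ler_norm (- t1); have := ler_norm (- t2); have := ler_norm (- s1).
    have := ler_norm (- s2); rewrite !normrN.
    have := normr_ge0 t1; have := normr_ge0 t2; have := normr_ge0 s1; have := normr_ge0 s2.
    by move=> *; apply/andP; split; lra.
  have h2 := sqr_dist (time Q.2 _) (time Q'.2 _).
  rewrite Q2 Q3 Q2' Q3' in h2; have {}h2 := h2 isT isT.
  have h3 : a S * (sqd S.1 Q.1 - sqd S.1 Q'.1) <=
      `|A| * (2 * (`|rho| + `|rho'|)) * enorm (Q.1 - Q'.1).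
    apply: le_trans (ler_wpM2l a0 h1) _; rewrite [leLHS]mulrA.
    apply: ler_wpM2r; first exact: enorm_ge0.
    rewrite (ger0_norm r0) (ger0_norm r0') (ger0_norm A0).
    by apply: ler_wpM2r => //; rewrite mulr_ge0// addr_ge0.
  have h4 := ler_wpM2l b0 h2.
  have h5 : 0 <= (b * (2 * M) + 1) * enorm (Q.1 - Q'.1).
    by rewrite mulr_ge0 ?enorm_ge0//; lra.
  have h6 : 0 <= (`|A| * (2 * (`|rho| + `|rho'|)) + 1) * `|Q.2 - Q'.2|.
    by rewrite mulr_ge0//; lra.
  rewrite /L; move: h h3 h4 h5 h6.
  move: (enorm _) `|Q.2 - _| (`|A| * _) => e1 e2 e3 *; lra.
move=> Q Q' hQ hQ'; rewrite ler_norml; apply/andP; split; last exact: half.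
by have := half _ _ hQ' hQ; rewrite enormB distrC; lra.
Qed.

Lemma enorm_small (e : R) : 0 < e ->
  exists2 d : R, 0 < d & forall y : V, `|y| < d -> enorm y < e.
Proof.
move=> e0; have [d d0 hd] := enorm_dist (0 : V) e0; exists d => // y yd.
have := hd y; rewrite sub0r normrN => /(_ yd).
by rewrite enorm0 sub0r normrN ger0_norm ?enorm_ge0.
Qed.

Lemma norm_pair_ltE {E' F' : normedModType R} (z : E' * F') d :
  `|z| < d -> `|z.1| < d /\ `|z.2| < d.
Proof. by rewrite {1}/Num.Def.normr/= gt_max => /andP[]. Qed.

Lemma box_lipschitz_continuous (W : E -> R) (c : V) :
  (forall rho t1 t2, exists2 L, 0 < L & forall Q Q', box c rho t1 t2 Q ->
     box c rho t1 t2 Q' ->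
     `|W Q - W Q'| <= L * (enorm (Q.1 - Q'.1) + `|Q.2 - Q'.2|)) ->
  continuous W.
Proof.
move=> h; apply: continuous_distP => Q e e0.
have [L L0 hL] := h (enorm (Q.1 - c) + 1) (Q.2 - 1) (Q.2 + 1).
have e2 : 0 < Num.min (e / L / 2) 1 by rewrite lt_min !divr_gt0/=.
have [d d0 hd] := enorm_small e2.
exists (Num.min d (Num.min (e / L / 2) 1)); first by rewrite lt_min d0.
move=> Q'; rewrite lt_min => /andP[/norm_pair_ltE[/hd q1 _] /norm_pair_ltE[_]].
move: q1; rewrite !lt_min /= => /andP[E1 E2] /andP[T1 T2].
apply: le_lt_trans (hL _ _ _ _) _.
- by split => /=; [rewrite lerDl | apply/andP; split; lra].
- split; first by have := ler_enorm_dist Q'.1 Q.1 c; rewrite (enormB Q'.1 Q.1); lra.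
  by move: T2; rewrite ltr_norml => /andP[? ?]; apply/andP; split; lra.
have : enorm (Q.1 - Q'.1) + `|Q.2 - Q'.2| < e / L by lra.
by rewrite ltr_pdivlMr// mulrC.
Qed.

Lemma infconv_continuous (K : set E) (G a : E -> R) (b A : R) (sel : E -> E)
    (c : V) rho t1 t2 :
  (forall Q, K (sel Q) /\
    forall S, K S -> G (sel Q) + qpen a b Q (sel Q) <= G S + qpen a b Q S) ->
  (forall S, K S -> box c rho t1 t2 S) ->
  (forall S, K S -> 0 <= a S <= A) -> 0 <= b ->
  continuous (fun Q => G (sel Q) + qpen a b Q (sel Q)).
Proof.
move=> h1 h2 h3 h4; apply: (@box_lipschitz_continuous _ c) => rho' s1 s2.
exact: (infconv_lipschitz _ _ _ h1 h2 h3 h4).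
Qed.

Lemma nbhs_boxP (z : E) (P : set E) : (\forall w \near z, P w) ->
  exists2 d, 0 < d & forall w, enorm (w.1 - z.1) <= d -> `|w.2 - z.2| <= d -> P w.
Proof.
move=> /nbhs_ballP[d /= d0 h]; exists (d / 2); first by rewrite divr_gt0.
have dd : d / 2 < d by rewrite ltr_pdivrMr// ltr_pMr// ltr1n.
move=> w w1 w2; apply: h; rewrite -ball_normE/=; apply: norm_pair_lt => /=.
  rewrite distrC (le_lt_trans (enorm_norm _))//.
  exact: le_lt_trans w1 _.
by rewrite distrC (le_lt_trans w2).
Qed.

Lemma box_nbhs (z : E) (P : set E) d : 0 < d ->
  (forall w, enorm (w.1 - z.1) < d -> `|w.2 - z.2| < d -> P w) ->
  \forall w \near z, P w.
Proof.
move=> d0 h; have [d' d'0 hd'] := enorm_small d0.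
apply/nbhs_ballP; exists (Num.min d d') => /=; first by rewrite lt_min d0.
move=> w; rewrite -ball_normE/= lt_min => /andP[/norm_pair_ltE[_ w2]].
move=> /norm_pair_ltE[w1 _].
by apply: h; [apply: hd'; rewrite distrC | rewrite distrC].
Qed.

Lemma C1w_dir (E' : normedModType R) (f : E' -> R) df (z e : E') (eta : R) :
  C1w f df -> 0 < eta ->
  exists2 h1, 0 < h1 & forall h, 0 < h <= h1 ->
    `|f (z + h *: e) - f z - h * df z e| <= h * eta.
Proof.
move=> hf eta0; have [fd _] := hf.
have fdz := fd z; have dfz : differentiable f z by exact: ex_diff.
have dv : derivable f z e by apply: diff_derivable.
have : (fun h => h^-1 *: ((f \o shift z) (h *: e) - f z)) @ 0^' --> df z e.
  by rewrite -(C1w_diffE _ _ hf) -deriveE//; exact: dv.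
move=> /cvgrPdist_lt/(_ _ eta0); rewrite near_withinE => /nbhs_ballP[d /= d0 hd].
exists (d / 2); first by rewrite divr_gt0.
move=> h /andP[h0 hle]; have := hd h; rewrite -ball_normE/= sub0r normrN gtr0_norm//.
have hd2 : h < d by apply: le_lt_trans hle _; rewrite ltr_pdivrMr// ltr_pMr// ltr1n.
move=> /(_ hd2); rewrite gt_eqF// => /(_ isT) /ltW hh.
rewrite (_ : f _ - f z - _ = - (h * (df z e - h^-1 * (f (h *: e + z) - f z)))); last first.
  by rewrite [h *: e + z]addrC; field; rewrite gt_eqF.
by rewrite normrN normrM gtr0_norm// ler_wpM2l// ltW.
Qed.

End InfConvolution.

(** * Test functions touching from below *)

Section BarronJensen.
Context {R : realType} {n : nat}.
Notation V := 'rV[R]_n.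
Notation E := (V * R)%type.

(** The inequalities are required at all times: a Hamiltonian given on [[0, T]] is first frozen in
    time outside that interval. *)
Record hamiltonian (H : V -> R -> R -> V -> R) (C1 beta A2 B2 K3 : R) : Prop := {
  ham_cont : continuous (fun w : V * R * R * V => H w.1.1.1 w.1.1.2 w.1.2 w.2);
  ham_C1 : 0 <= C1;
  ham_beta : 0 <= beta;
  ham_B2 : 0 <= B2;
  ham_A2 : 0 <= A2;
  ham_K3 : 0 <= K3;
  ham_x : forall t v p x y,
    `|H x t v p - H y t v p| <= C1 * (beta + enorm p) * enorm (x - y);
  ham_p : forall x t v p q,
    `|H x t v p - H x t v q| <= (A2 * enorm x + B2) * enorm (p - q);
  ham_u : forall x t p v w, `|H x t v p - H x t w p| <= K3 * `|v - w|;
  ham_cvx : forall x t v p q (l : R), 0 <= l <= 1 ->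
    H x t v (l *: p + (1 - l) *: q) <= l * H x t v p + (1 - l) * H x t v q }.

Definition diff_of (g : E -> V) (tau : E -> R) : E -> E -> R :=
  fun z v => dotv (g z) v.1 + tau z * v.2.

(** The test functions are globally C1 with explicit gradient [g] and time derivative [tau]. They
    form a subclass of those in the definition of viscosity solution, so these inequalities follow
    from it. *)
Definition subsolution (T : R) (H : V -> R -> R -> V -> R) (u : E -> R) :=
  forall (phi : E -> R) g tau (z : E), C1w phi (diff_of g tau) -> 0 < z.2 < T ->
    (\forall w \near z, u w - phi w <= u z - phi z) ->
    tau z + H z.1 z.2 (u z) (g z) <= 0.

Definition supersolution (T : R) (H : V -> R -> R -> V -> R) (u : E -> R) :=
  forall (phi : E -> R) g tau (z : E), C1w phi (diff_of g tau) -> 0 < z.2 < T ->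
    (\forall w \near z, u z - phi z <= u w - phi w) ->
    0 <= tau z + H z.1 z.2 (u z) (g z).

Lemma dotv_evec (p : V) i : dotv p (evec i) = p 0 i.
Proof.
rewrite /dotv (bigD1 i)//= big1 => [|j ji].
  by rewrite /evec mxE !eqxx mulr1 addr0.
by rewrite /evec mxE (negbTE ji) mulr0.
Qed.

Lemma C1w_quad (a b : R) (y0 : V) (s0 : R) :
  C1w (fun w : E => a * sqd w.1 y0 + b * (w.2 - s0) ^+ 2)
    (diff_of (fun w => (2 * a) *: (w.1 - y0)) (fun w => 2 * b * (w.2 - s0))).
Proof.
have h1 := C1w_scale a (C1w_fst (F := R) (C1w_sq y0)).
have h2 : C1w (fun z : E => z.2 - s0) (fun z v => v.2 + 0).
  exact: C1w_add C1w_snd (C1w_cst (- s0)).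
apply: C1w_ext (C1w_add h1 (C1w_scale b (C1w_mul h2 h2))) _ _ => [z|z v].
  by rewrite expr2.
by rewrite /diff_of dotvZl; ring.
Qed.

Lemma C1w_diff_of_add f f' g g' tau tau' :
  C1w f (diff_of g tau) -> C1w f' (diff_of g' tau') ->
  C1w (fun z => f z + f' z)
    (diff_of (fun z => g z + g' z) (fun z => tau z + tau' z)).
Proof.
move=> h h'; apply: C1w_ext (C1w_add h h') _ _ => // z v.
by rewrite /diff_of dotvDl; ring.
Qed.

Lemma C1w_diff_of_opp f g tau : C1w f (diff_of g tau) ->
  C1w (fun z => - f z) (diff_of (fun z => - g z) (fun z => - tau z)).
Proof.
move=> h; apply: C1w_ext (C1w_scale (-1) h) _ _ => [z|z v]; first by rewrite mulN1r.
by rewrite /diff_of dotvNl; ring.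
Qed.

Lemma C1w_diff_of_scale (a : R) f g tau : C1w f (diff_of g tau) ->
  C1w (fun z => a * f z) (diff_of (fun z => a *: g z) (fun z => a * tau z)).
Proof.
move=> h; apply: C1w_ext (C1w_scale a h) _ _ => // z v.
by rewrite /diff_of dotvZl; ring.
Qed.

Lemma diff_of_cont_time f g tau : C1w f (diff_of g tau) -> continuous tau.
Proof.
move=> [_ /(_ (0, 1))]; rewrite (_ : (fun _ => _) = tau)//.
by apply/funext => z; rewrite /diff_of/= dotvC dotv0l add0r mulr1.
Qed.

(** [C1w] gives continuity of the differential in each fixed direction only, that is, of each
    coordinate of [g]; the norm is rebuilt from the coordinates. *)
Lemma diff_of_cont_space f g tau (p : V) : C1w f (diff_of g tau) ->
  continuous (fun z => enorm (g z - p)).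
Proof.
move=> [_ h].
have hi i : continuous (fun z => g z 0 i - p 0 i).
  apply: contD; last exact: cont_cst.
  rewrite (_ : (fun _ => _) = fun z => diff_of g tau z (evec i, 0)); first exact: h.
  by apply/funext => z; rewrite /diff_of/= mulr0 addr0 dotv_evec.
apply: (cont_comp (f := fun z => dotv (g z - p) (g z - p)) _
  (@sqrt_continuous R)).
rewrite (_ : (fun _ => _) = fun z => \sum_i (g z 0 i - p 0 i) * (g z 0 i - p 0 i)).
  exact: (cont_sum (fun i => contM (hi i) (hi i))).
by apply/funext => z; apply: eq_bigr => i _; rewrite !mxE.
Qed.

(** The sup-convolution [f] of [u] can be minimized against a perturbation of [phi]. Its maximizing
    points are points where a quadratic touches [u] from above, so the subsolution inequality is
    available there; the shift of the base point carries it back to the slope of [phi]. *)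
Theorem barron_jensen T H C1 beta A2 B2 K3 (u : E -> R) :
  hamiltonian H C1 beta A2 B2 K3 -> continuous u -> subsolution T H u ->
  forall (phi : E -> R) g tau (z : E), C1w phi (diff_of g tau) -> 0 < z.2 < T ->
    (\forall w \near z, u z - phi z <= u w - phi w) ->
    tau z + H z.1 z.2 (u z) (g z) <= 0.
Proof.
move=> hH uc usub phi g tau z hphi /andP[z0 zT] zmin.
rewrite leNgt; apply/negP => G0.
have [Hc C10 b0 B20 A20 K30 Hx Hp Hu Hcvx] := hH.
(* Of these ten units of excess, at most two are lost in passing from [z] to the minimum point [S]
   and five in passing from [S] to the point [X] where [u] is tested. *)
pose gam := (tau z + H z.1 z.2 (u z) (g z)) / 10.
have gam0 : 0 < gam by rewrite divr_gt0.
(* Subtracting the squared distance makes the minimum at [z] strict, which localizes the minimum of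
   [f - phi']. *)
pose phi' w := phi w + - (1 * sqd w.1 z.1 + 1 * (w.2 - z.2) ^+ 2).
pose g' w := g w + - ((2 * 1) *: (w.1 - z.1)).
pose tau' w := tau w + - (2 * 1 * (w.2 - z.2)).
have hphi' : C1w phi' (diff_of g' tau').
  exact: (C1w_diff_of_add hphi (C1w_diff_of_opp (C1w_quad 1 1 z.1 z.2))).
pose r1 := gam / (2 * K3 + 4 * C1 + 1).
have den0 : 0 < 2 * K3 + 4 * C1 + 1 by lra.
have r10 : 0 < r1 by rewrite divr_gt0.
have r1K : 2 * K3 * r1 + 4 * C1 * r1 <= gam.
  have -> : gam = 2 * K3 * r1 + 4 * C1 * r1 + r1.
    by rewrite /r1; field; rewrite gt_eqF.
  by rewrite lerDl ltW.
have K3r : 0 <= K3 * r1 by rewrite mulr_ge0// ltW.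
have C1r : 0 <= C1 * r1 by rewrite mulr_ge0// ltW.
(* By (H2) this is a continuous lower bound for [tau' S + H] at value [u z] and slope [g' S], equal
   to it at [z]. *)
pose Phi S := tau' S + (- ((A2 * enorm S.1 + B2) * enorm (g' S - g z))
   + H S.1 S.2 (u z) (g z)).
have enc : continuous (fun S : E => enorm S.1).
  apply: (cont_comp (f := fst : E -> V) _ (@enorm_continuous R n)).
  by move=> w; exact: cvg_fst.
have Phic : continuous Phi.
  apply: contD; first exact: diff_of_cont_time hphi'.
  apply: contD.
    have gc := diff_of_cont_space (p := g z) hphi'.
    apply: contN; apply: (contM _ gc).
    by apply: contD; [apply: contM => //; exact: cont_cst | exact: cont_cst].
  apply: (cont_comp (f := fun S : E => (S.1, S.2, u z, g z)) _ Hc).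
  apply: (cont_pair (f := fun S : E => (S.1, S.2, u z)) _ (@cst_continuous _ _ _)).
  apply: (cont_pair (f := fun S : E => (S.1, S.2)) _ (@cst_continuous _ _ _)).
  apply: (cont_pair (f := fun S : E => S.1)) => w; first exact: cvg_fst.
  exact: cvg_snd.
have g'z : g' z = g z by rewrite /g' subrr scaler0 subr0.
have tau'z : tau' z = tau z by rewrite /tau' subrr mulr0 subr0.
have Phiz : Phi z = 10 * gam.
  by rewrite /Phi g'z tau'z subrr enorm0 mulr0 oppr0 add0r /gam; field.
have near1 : \forall S \near z, [/\ u z - phi z <= u S - phi S,
    `|u z - u S| < r1 & `|Phi z - Phi S| < gam].
  near=> S; split; near: S => //.
    by move/cvgrPdist_lt : (uc z) => /(_ _ r10).
  by move/cvgrPdist_lt : (Phic z) => /(_ _ gam0).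
have [d d0 hd] := nbhs_boxP near1.
pose rho := Num.min (Num.min d (z.2 / 2)) (Num.min ((T - z.2) / 2)
  (gam / (2 * C1 * beta + 1))).
have C1b : 0 <= C1 * beta by rewrite mulr_ge0.
have den1 : 0 < 2 * C1 * beta + 1 by rewrite -mulrA; lra.
have rho0 : 0 < rho by rewrite !lt_min d0 !divr_gt0// subr_gt0.
have rhod : rho <= d by rewrite /rho !ge_min lexx.
have rhoz : rho <= z.2 / 2 by rewrite /rho !ge_min lexx !orbT.
have rhoT : rho <= (T - z.2) / 2 by rewrite /rho !ge_min lexx !orbT.
have rhob : C1 * beta * (2 * rho) <= gam.
  have : rho <= gam / (2 * C1 * beta + 1) by rewrite /rho !ge_min lexx !orbT.
  by rewrite ler_pdivlMr// => ?; lra.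
clearbody rho.
pose K := box z.1 rho (z.2 - rho) (z.2 + rho).
have KP w : enorm (w.1 - z.1) <= rho -> `|w.2 - z.2| <= rho -> K w.
  by move=> w1; rewrite ler_distl => w2.
have PK w : K w -> enorm (w.1 - z.1) <= rho /\ `|w.2 - z.2| <= rho.
  by move=> [w1 w2]; rewrite ler_distl.
have Kz : K z by apply: KP; rewrite subrr ?enorm0 ?normr0 ltW.
have hK w : K w -> [/\ u z - phi z <= u w - phi w,
    `|u z - u w| < r1 & `|Phi z - Phi w| < gam].
  by move=> /PK[w1 w2]; apply: hd; [exact: le_trans w1 _|exact: le_trans w2 _].
have Kc : compact K by exact: box_compact.
(* At the point z itself the sup-convolution is close to u, so the minimum of
   f - phi' is attained within rho / 4 of z. *)
have rho4 : 0 < (rho / 4) ^+ 2 by rewrite exprn_gt0// divr_gt0.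
have [d1 d10 hd1] : exists2 d1, 0 < d1 &
    forall w : E, enorm (w.1 - z.1) <= d1 -> `|w.2 - z.2| <= d1 ->
      `|u z - u w| < (rho / 4) ^+ 2.
  apply: nbhs_boxP; by move/cvgrPdist_lt : (uc z) => /(_ _ rho4).
pose d2 := Num.min d1 (rho / 4).
have d20 : 0 < d2 by rewrite lt_min d10 divr_gt0.
have d2d1 : d2 <= d1 by rewrite /d2 ge_min lexx.
have d2rho : d2 <= rho / 4 by rewrite /d2 ge_min lexx orbT.
pose ep := d2 ^+ 2 / (8 * r1).
have ep0 : 0 < ep by apply: divr_gt0; [exact: exprn_gt0 | exact: mulr_gt0].
have epd : 4 * ep * r1 <= d2 ^+ 2.
  have -> : 4 * ep * r1 = d2 ^+ 2 / 2 by rewrite /ep; field; rewrite gt_eqF.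
  by have := exprn_gt0 2 d20; clear; lra.
(* The modulus of [H] in time depends on the slope bound [2 * rho / ep], so time needs its own
   parameter [ep'], chosen after [ep]. *)
have [d3 d30 hd3] := @hamiltonian_unif_time R n H z.1 rho (z.2 - rho) (z.2 + rho)
  (`|u z| + r1) (2 * rho / ep) Hc _ gam0.
pose d4 := Num.min d2 (d3 / 2).
have d40 : 0 < d4 by rewrite lt_min d20 divr_gt0.
have d4d2 : d4 <= d2 by rewrite /d4 ge_min lexx.
have d4d3 : d4 <= d3 / 2 by rewrite /d4 ge_min lexx orbT.
pose ep' := d4 ^+ 2 / (8 * r1).
have ep'0 : 0 < ep' by apply: divr_gt0; [exact: exprn_gt0 | exact: mulr_gt0].
have epd' : 4 * ep' * r1 <= d4 ^+ 2.
  have -> : 4 * ep' * r1 = d4 ^+ 2 / 2 by rewrite /ep'; field; rewrite gt_eqF.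
  by have := exprn_gt0 2 d40; clear; lra.
have [sel hsel] := @infconv_argmin R n K (fun S => - u S) (fun=> (2 * ep)^-1)
  (2 * ep')^-1 (ex_intro _ z Kz) Kc (contN uc) (@cont_cst _ _ _).
pose pen (Q S : E) := qpen (fun=> (2 * ep)^-1) (2 * ep')^-1 Q S.
have ep2 : 0 < 2 * ep by exact: mulr_gt0.
have ep2' : 0 < 2 * ep' by exact: mulr_gt0.
have iep0 : 0 < (2 * ep)^-1 by rewrite invr_gt0 mulr_gt0.
have iep'0 : 0 < (2 * ep')^-1 by rewrite invr_gt0 mulr_gt0.
have pen0 Q S : 0 <= pen Q S.
  by rewrite addr_ge0// mulr_ge0 ?sqd_ge0 ?sqr_ge0// ltW.
pose f Q := - (- u (sel Q) + pen Q (sel Q)).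
have fE Q : f Q = u (sel Q) - pen Q (sel Q) by rewrite /f opprD opprK.
have fc : continuous f.
  apply: contN; apply: (@infconv_continuous _ _ K (fun S => - u S)
    (fun=> (2 * ep)^-1) _ (2 * ep)^-1 sel z.1 rho (z.2 - rho) (z.2 + rho)) => //.
    by move=> S _; rewrite lexx ltW.
  exact: ltW.
have selK Q : K (sel Q) by have [] := hsel Q.
have fge Q S : K S -> u S - pen Q S <= f Q.
  move=> KS; rewrite /f; have [_ /(_ _ KS)] := hsel Q.
  by rewrite -/(pen _ _) -/(pen _ _); clear; lra.
have penxx Q : pen Q Q = 0.
  by rewrite /pen /qpen sqdxx subrr expr0n/= !mulr0 addr0.
have fgeu S : K S -> u S <= f S by move=> /(fge S S); rewrite penxx subr0.
have fler Q : K Q -> `|f Q - u z| <= r1.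
  move=> KQ; rewrite ler_norml; have [_ + _] := hK _ KQ.
  have [_ + _] := hK _ (selK Q); rewrite !ltr_norml => /andP[a1 a2] /andP[a3 a4].
  have e1 := fgeu _ KQ; have e2 := fE Q; have e3 := pen0 Q (sel Q).
  by apply/andP; split; [clear -e1 a4 | clear -e2 e3 a1]; lra.
have penle Q : K Q -> pen Q (sel Q) <= 2 * r1.
  move=> KQ; have := fgeu _ KQ; rewrite fE.
  have [_ + _] := hK _ KQ; have [_ + _] := hK _ (selK Q).
  by rewrite !ltr_norml => /andP[a1 a2] /andP[a3 a4] a5; clear -a1 a4 a5 a2 a3; lra.
have selx Q : K Q -> enorm ((sel Q).1 - Q.1) ^+ 2 <= 4 * ep * r1.
  move=> KQ; have := penle _ KQ; rewrite /pen /qpen sqdE.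
  have : 0 <= (2 * ep')^-1 * ((sel Q).2 - Q.2) ^+ 2 by rewrite mulr_ge0 ?sqr_ge0// ltW.
  move=> h1 h2; have {h1 h2} : (2 * ep)^-1 * enorm ((sel Q).1 - Q.1) ^+ 2 <= 2 * r1.
    by clear -h1 h2; lra.
  by rewrite ler_pdivrMl// => h; clear -h; lra.
have selt Q : K Q -> `|(sel Q).2 - Q.2| <= d4.
  move=> KQ; rewrite -ler_sqr ?nnegrE ?(ltW d40)// real_normK ?num_real//.
  apply: le_trans epd'; have := penle _ KQ; rewrite /pen /qpen.
  have : 0 <= (2 * ep)^-1 * sqd (sel Q).1 Q.1 by rewrite mulr_ge0 ?sqd_ge0// ltW.
  move=> h1 h2; have {h1 h2} : (2 * ep')^-1 * ((sel Q).2 - Q.2) ^+ 2 <= 2 * r1.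
    by clear -h1 h2; lra.
  by rewrite ler_pdivrMl// => h; clear -h; lra.
have selx' Q : K Q -> enorm ((sel Q).1 - Q.1) <= d2.
  move=> KQ; rewrite -ler_sqr ?nnegrE ?enorm_ge0 ?(ltW d20)//.
  exact: le_trans (selx _ KQ) epd.
have [S KS Smin] := @compact_argmin _ _ K (fun w => f w + - phi' w)
  (ex_intro _ z Kz) Kc (contD fc (contN (C1w_continuous hphi'))).
have Sz : sqd S.1 z.1 + (S.2 - z.2) ^+ 2 < (rho / 4) ^+ 2.
  have := Smin _ Kz; rewrite /phi' !mul1r sqdxx subrr expr0n/= addr0 oppr0 addr0.
  have [+ _ _] := hK _ KS; have := fgeu _ KS; have := fE z.
  have := pen0 z (sel z).
  have := hd1 (sel z) (le_trans (selx' _ Kz) d2d1)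
    (le_trans (selt _ Kz) (le_trans d4d2 d2d1)).
  by rewrite ltr_norml => /andP[a1 a2] a3 a4 a5 a6 a7; clear -a1 a2 a3 a4 a5 a6 a7; lra.
have rho40 : 0 < rho / 4 by rewrite divr_gt0.
have S1 : enorm (S.1 - z.1) <= rho / 4.
  rewrite -ler_sqr ?nnegrE ?enorm_ge0 ?(ltW rho40)// -sqdE.
  by have := sqr_ge0 (S.2 - z.2); clear -Sz; lra.
have S2 : `|S.2 - z.2| <= rho / 4.
  rewrite -ler_sqr ?nnegrE ?(ltW rho40)// real_normK ?num_real//.
  by have := sqd_ge0 S.1 z.1; clear -Sz; lra.
have low : 8 * gam <= tau' S + H S.1 S.2 (f S) (g' S).
  have [_ _] := hK _ KS; rewrite Phiz ltr_norml => /andP[_]; rewrite /Phi => h1.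
  have := Hp S.1 S.2 (f S) (g' S) (g z); rewrite ler_norml => /andP[h2 _].
  have := Hu S.1 S.2 (g z) (f S) (u z); rewrite ler_norml => /andP[h3 _].
  have h4 : K3 * `|f S - u z| <= K3 * r1 by rewrite ler_wpM2l// fler.
  by clear -h1 h2 h3 h4 r1K K3r C1r; lra.
have [v hv] := @convex_approx_subgradient _ _ (H S.1 S.2 (f S)) _
  (Hp S.1 S.2 (f S)) (Hcvx S.1 S.2 (f S)) (g' S) _ gam0.
have [h1 h10 hh1] := C1w_dir S ((v, 1) : E) hphi' gam0.
pose ev := enorm v.
have ev0 : 0 <= ev by exact: enorm_ge0.
have ev1 : 0 < ev + 1 by clear -ev0; lra.
pose h0 := Num.min h1 (Num.min (rho / 4 / (ev + 1)) (d3 / 4)).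
have h00 : 0 < h0 by rewrite !lt_min h10 !divr_gt0.
pose M := dotv v v / (2 * ep) + 1 / (2 * ep') + C1 * (beta + 2 * rho / ep) * ev.
suff : gam <= 0 by rewrite leNgt gam0.
apply: (@le0_of_small _ _ M h0) => // h /andP[hp];
rewrite !le_min => /andP[hh /andP[hrho hd3h]].
have hv4 : h * (ev + 1) <= rho / 4 by rewrite -ler_pdivlMr.
have hev : 0 <= h * ev by rewrite mulr_ge0// ltW.
pose S' : E := S + h *: ((v, 1) : E).
have S'1 : S'.1 = S.1 + h *: v by [].
have S'2 : S'.2 = S.2 + h by rewrite /S'/= [h *: _]mulr1.
have S'z1 : enorm (S'.1 - z.1) <= rho / 2.
  rewrite S'1 addrAC; apply: le_trans (ler_enormD _ _) _.
  by rewrite enormZ gtr0_norm// -/ev; clear -S1 hv4 hp; lra.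
have S'z2 : `|S'.2 - z.2| <= rho / 2.
  rewrite S'2 addrAC; apply: le_trans (ler_normD _ _) _.
  by rewrite (gtr0_norm hp); clear -S2 hv4 hev; lra.
have rho2 : rho / 2 <= rho by clear -rho0; lra.
have KS' : K S' by apply: KP; [exact: le_trans S'z1 _ | exact: le_trans S'z2 _].
pose X := sel S'.
have KX : K X by exact: selK.
have X1 : enorm (X.1 - S'.1) <= d2 by exact: selx'.
have X2 : `|X.2 - S'.2| <= d4 by exact: selt.
pose p := (2 * (2 * ep)^-1) *: (X.1 - S'.1).
pose ta := 2 * (2 * ep')^-1 * (X.2 - S'.2).
have Xz1 : enorm (X.1 - z.1) <= rho * (3 / 4).
  by have := ler_enorm_dist X.1 S'.1 z.1; clear -X1 S'z1 d2rho; lra.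
have Xz2 : `|X.2 - z.2| <= rho * (3 / 4).
  by have := ler_distD S'.2 X.2 z.2; clear -X2 S'z2 d2rho d4d2; lra.
have visc : ta + H X.1 X.2 (u X) p <= 0.
  apply: (usub _ _ _ X (C1w_quad (2 * ep)^-1 (2 * ep')^-1 S'.1 S'.2)).
    by move: Xz2; rewrite ler_distl => /andP[a1 a2]; apply/andP; split; clear -a1 a2 rhoz rhoT rho0 z0 zT; lra.
  apply: (box_nbhs (d := rho / 4)) => // w w1 w2.
  have Kw : K w.
    apply: KP; first by have := ler_enorm_dist w.1 X.1 z.1; clear -w1 Xz1; lra.
    by have := ler_distD X.2 w.2 z.2; clear -w2 Xz2; lra.
  have := fge S' _ Kw; rewrite fE -/X /pen /qpen; clear; lra.
have pE : p = ep^-1 *: (X.1 - S'.1) by rewrite /p invfM mulrA divff// mul1r.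
have taE : ta = ep'^-1 * (X.2 - S'.2) by rewrite /ta invfM mulrA divff// mul1r.
(* The increment [f S' - f S] is at least that of [phi'], as [S] is a minimum point, and at most the
   change of penalty with [X] fixed, as [X] is optimal at [S'] and a competitor at [S]. *)
have step : h * (dotv (g' S) v + tau' S - gam) <=
    h * (dotv v p + ta) + h ^+ 2 * (dotv v v / (2 * ep) + 1 / (2 * ep')).
  have := hh1 h; rewrite hp hh => /(_ isT); rewrite -/S' /diff_of/= mulr1.
  rewrite ler_norml => /andP[k1 _].
  have k2 := Smin _ KS'; have k3 := fge S _ KX.
  have k4 := fE S'; rewrite -/X in k4.
  have k5 : pen S X - pen S' X = h * (dotv v p + ta) + h ^+ 2 *
      (dotv v v / (2 * ep) + 1 / (2 * ep')).
    have e1 : S.1 = S'.1 + (- h) *: v by rewrite S'1 scaleNr addrK.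
    have e2 : S.2 = S'.2 - h by rewrite S'2 addrK.
    rewrite /pen /qpen (sqdC _ S.1) e1 e2 sqdD (sqdC S'.1) pE taE.
    rewrite -(opprB X.1) dotvNr dotvZr; field.
    by rewrite !gt_eqF.
  by clear -k1 k2 k3 k4 k5; lra.
have {}step : dotv (g' S) v + tau' S - gam <=
    dotv v p + ta + h * (dotv v v / (2 * ep) + 1 / (2 * ep')).
  rewrite -(ler_pM2l hp); apply: le_trans step _.
  by rewrite le_eqVlt; apply/orP; left; apply/eqP; ring.
have cvx := hv p; rewrite dotvDr dotvNr in cvx.
have penorm : enorm p = ep^-1 * enorm (X.1 - S'.1).
  by rewrite pE enormZ gtr0_norm// invr_gt0.
have p2 : enorm p <= 2 * rho / ep.
  rewrite penorm mulrC ler_wpM2r ?invr_ge0 ?(ltW ep0)//.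
  by clear -X1 d2rho rho0; lra.
have sh1 : H S.1 S.2 (f S) p - H X.1 S.2 (f S) p <=
    2 * gam + h * (C1 * (beta + 2 * rho / ep) * ev) - 2 * K3 * r1.
  have := Hx S.2 (f S) p S.1 X.1; rewrite ler_norml => /andP[_ k1].
  apply: le_trans k1 _.
  have k2 : enorm (S.1 - X.1) <= enorm (X.1 - S'.1) + h * ev.
    rewrite enormB; apply: le_trans (ler_enorm_dist _ S'.1 _) _.
    by rewrite lerD2l S'1 [_ + _ - S.1]addrAC subrr add0r enormZ (gtr0_norm hp).
  have c0 : 0 <= C1 * (beta + enorm p) by rewrite mulr_ge0// addr_ge0// enorm_ge0.
  apply: le_trans (ler_wpM2l c0 k2) _; rewrite mulrDr.
  have k3 : C1 * (beta + enorm p) * (h * ev) <= h * (C1 * (beta + 2 * rho / ep) * ev).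
    rewrite mulrCA; apply: ler_wpM2l; first exact: ltW.
    by apply: ler_wpM2r => //; apply: ler_wpM2l => //; rewrite lerD2l.
  have k4 : C1 * beta * enorm (X.1 - S'.1) <= gam.
    by apply: le_trans rhob; apply: ler_wpM2l => //; clear -X1 d2rho rho0; lra.
  (* Here [|p| |X.1 - S'.1| = |X.1 - S'.1|^2 / ep], which the oscillation of [u] bounds by [4 * r1]
     uniformly in [ep]; this is what the growth of (H1) in [p] requires. *)
  have k5 : C1 * enorm p * enorm (X.1 - S'.1) <= C1 * (4 * r1).
    rewrite -mulrA; apply: ler_wpM2l => //.
    by rewrite penorm -mulrA -expr2 ler_pdivrMl// mulrCA mulrA selx.
  by clear -k3 k4 k5 r1K; lra.
have sh2 : H X.1 S.2 (f S) p - H X.1 X.2 (f S) p < gam.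
  have XS : `|S.2 - X.2| < d3.
    have e : `|S.2 - S'.2| = h.
      by rewrite S'2 opprD addrA subrr sub0r normrN (gtr0_norm hp).
    have := ler_distD S'.2 S.2 X.2; rewrite e (distrC S'.2).
    by clear -X2 d4d3 hd3h d30; lra.
  have bX : box z.1 rho (z.2 - rho) (z.2 + rho) (X.1, S.2).
    by have [? _] := KX; have [_ ?] := KS; split.
  have fb : `|f S| <= `|u z| + r1.
    have := fler _ KS; have := ler_normD (f S - u z) (u z).
    by rewrite subrK; clear; lra.
  by have := hd3 _ _ _ _ _ bX fb p2 XS; rewrite ltr_norml => /andP[].
have sh3 : H X.1 X.2 (f S) p - H X.1 X.2 (u X) p <= 2 * K3 * r1.
  have := Hu X.1 X.2 p (f S) (u X); rewrite ler_norml => /andP[_ k1].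
  apply: le_trans k1 _; rewrite (_ : 2 * K3 * r1 = K3 * (2 * r1)); last by ring.
  apply: ler_wpM2l => //.
  have [_ k2 _] := hK _ KX; have := fler _ KS.
  by have := ler_distD (u z) (f S) (u X); clear -k2; lra.
rewrite /M mulrDr; move: (dotvC (g' S) v) => dc; rewrite dc in step.
by clear -gam0 step cvx sh1 sh2 sh3 low visc; lra.
Unshelve. all: by end_near. Qed.

End BarronJensen.

(** * The regularized subsolution *)

Section Regularization.
Context {R : realType} {n : nat}.
Notation V := 'rV[R]_n.
Notation E := (V * R)%type.

(* [sel Q] selects a minimizing point of the inf-convolution at [Q]; time is
   penalized only by [1 / (2 delta)] with [delta -> 0], to get a function that
   is Lipschitz in time as well. *)
Section Definitions.
Variables (u : E -> R) (k c : R -> R) (xb : V) (rho T : R).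

Definition arrival (S : E) : R := u S + c S.2.
Definition steep (S : E) : R := k S.2.
Definition penal (delta : R) := qpen steep (2 * delta)^-1.

(** The radius leaves room: base points within [rho + 1] have minimizers within [rho + 2], around
    which a unit ball still lies in the box, so the viscosity inequality can be tested there. *)
Definition minimal (delta : R) (sel : E -> E) := forall Q,
  box xb (rho + 3) 0 T (sel Q) /\ forall S, box xb (rho + 3) 0 T S ->
    arrival (sel Q) + penal delta Q (sel Q) <= arrival S + penal delta Q S.

Definition regularized (delta : R) (sel : E -> E) (Q : E) : R :=
  arrival (sel Q) + penal delta Q (sel Q).

Definition time_close (eta delta : R) (sel : E -> E) :=
  forall Q, box xb (rho + 1) 0 T Q ->
  [/\ enorm ((sel Q).1 - Q.1) <= 1, `|(sel Q).2 - Q.2| <= eta,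
      (2 * delta)^-1 * ((sel Q).2 - Q.2) ^+ 2 <= eta,
      `|u (sel Q) - u ((sel Q).1, Q.2)| <= eta &
      `|k (sel Q).2 - k Q.2| <= eta /\ `|c (sel Q).2 - c Q.2| <= eta].

End Definitions.

(** [C] bounds [u] on the box, so its oscillation is at most [2 * C]; the lower bound [2 * C <= k s]
    then keeps minimizers within distance 1 of the base point. *)
Record tilting (u : E -> R) (k k' c c' : R -> R) (xb : V) (rho T C kM : R) : Prop := {
  tilt_T : 0 < T;
  tilt_rho : 0 <= rho;
  tilt_u : continuous u;
  tilt_uC : forall S, box xb (rho + 3) 0 T S -> `|u S| <= C;
  tilt_kder : forall s, is_derive s (1 : R) k (k' s);
  tilt_cder : forall s, is_derive s (1 : R) c (c' s);
  tilt_k' : continuous k';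
  tilt_c' : continuous c';
  tilt_kC : forall s, 0 <= s <= T -> 2 * C <= k s <= kM;
  tilt_k0 : forall s, 0 <= s <= T -> 0 < k s;
  tilt_c0 : forall s, 0 <= s <= T -> 0 <= c s <= kM }.

Lemma is_derive_continuous (f f' : R -> R) :
  (forall s, is_derive s (1 : R) f (f' s)) -> continuous f.
Proof.
move=> h s; apply/differentiable_continuous/derivable1_diffP.
by have [] := h s.
Qed.

Lemma box_nonempty (xb : V) (r T : R) : 0 <= r -> 0 < T -> box xb r 0 T !=set0.
Proof.
by move=> r0 T0; exists (xb, 0); split; rewrite /= ?subrr ?enorm0// lexx ltW.
Qed.

Lemma regularized_exists (u : E -> R) (k k' c c' : R -> R)
    (xb : V) (rho T C kM : R) delta :
  tilting u k k' c c' xb rho T C kM ->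
  exists sel, minimal u k c xb rho T delta sel.
Proof.
move=> [T0 rho0 uc uC kder cder k'c c'c kpos kgt0 cge0].
have r3 : 0 <= rho + 3 by rewrite addr_ge0.
apply: (infconv_argmin _ (box_nonempty _ r3 T0)).
- exact: box_compact.
- apply: contD => //; apply: (cont_comp (f := snd : E -> R) _ (is_derive_continuous cder)).
  by move=> w; exact: cvg_snd.
- apply: (cont_comp (f := snd : E -> R) _ (is_derive_continuous kder)).
  by move=> w; exact: cvg_snd.
Qed.

(** The competitor is the base point moved to the time of the minimizer: [c] and the time penalty
    cancel, leaving [k d^2] against the oscillation of [u]. *)
Lemma minimal_close (u : E -> R) (k k' c c' : R -> R)
    (xb : V) (rho T C kM : R) delta sel Q :
  tilting u k k' c c' xb rho T C kM ->
  0 < delta -> minimal u k c xb rho T delta sel ->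
  box xb (rho + 1) 0 T Q -> enorm ((sel Q).1 - Q.1) <= 1.
Proof.
move=> [T0 rho0 uc uC kder cder k'c c'c kpos kgt0 cge0].
move=> d0 hsel [Q1 Q2]; have [[S1 S2] h] := hsel Q.
have KS : box xb (rho + 3) 0 T (Q.1, (sel Q).2).
  by split => //=; apply: le_trans Q1 _; clear; lra.
have := h _ KS; rewrite /arrival /penal /qpen /steep/= sqdxx mulr0 sqdE => h1.
have := uC _ KS; have := uC _ (conj S1 S2); rewrite !ler_norml => /andP[? ?] /andP[? ?].
have /andP[k1 _] := kpos _ S2; have k0 := kgt0 _ S2.
rewrite -ler_sqr ?nnegrE ?enorm_ge0// expr1n -(ler_pM2l k0) mulr1.
by lra.
Qed.

(** A two-stage estimate with the competitor [((sel Q).1, Q.2)]. Crude bounds and a small [delta]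
    first make the time gap small; uniform continuity of [u], [k] and [c] then makes the time
    penalty itself small. *)
Lemma time_close_exists (u : E -> R) (k k' c c' : R -> R)
    (xb : V) (rho T C kM : R) eta :
  tilting u k k' c c' xb rho T C kM -> 0 < eta ->
  exists2 delta, 0 < delta & forall sel, minimal u k c xb rho T delta sel ->
    time_close u k c xb rho T eta delta sel.
Proof.
move=> hT eta0; have [T0 rho0 uc uC kder cder k'c c'c kpos kgt0 cge0] := hT.
have eta3 : 0 < eta / 3 by rewrite divr_gt0.
have [d1 d10 hd1] := box_unif_continuous xb (rho + 3) 0 T uc eta3.
have [d2 d20 hd2] := compact_unif_continuous (@segment_compact R 0 T)
  (is_derive_continuous kder) eta3.
have [d3 d30 hd3] := compact_unif_continuous (@segment_compact R 0 T)
  (is_derive_continuous cder) eta3.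
pose d := Num.min (Num.min d1 d2) (Num.min d3 eta).
have d0 : 0 < d by rewrite !lt_min d10 d20 d30.
pose M := 2 * `|C| + 2 * `|kM| + 2 * `|kM| + 1.
have M0 : 0 < M by rewrite /M; have := normr_ge0 C; have := normr_ge0 kM; lra.
pose delta := d ^+ 2 / (4 * M).
have delta0 : 0 < delta by apply: divr_gt0; [exact: exprn_gt0 | exact: mulr_gt0].
have dM : 2 * delta * M < d ^+ 2.
  have -> : 2 * delta * M = d ^+ 2 / 2 by rewrite /delta; field; rewrite gt_eqF.
  by have := exprn_gt0 2 d0; clear; lra.
exists delta => // sel hsel Q hQ.
have near1 := minimal_close hT delta0 hsel hQ.
have [Q1 Q2] := hQ; have [[S1 S2] h] := hsel Q.
have KS : box xb (rho + 3) 0 T ((sel Q).1, Q.2) by [].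
have KS' : box xb (rho + 3) 0 T (sel Q) by [].
have := h _ KS; rewrite /arrival /penal /qpen /steep/= subrr expr0n/= mulr0 addr0 => h1.
have [D0 D1] : 0 <= sqd (sel Q).1 Q.1 /\ sqd (sel Q).1 Q.1 <= 1.
  by split; [exact: sqd_ge0 | rewrite sqdE expr_le1// enorm_ge0].
have k0 := kgt0 _ S2; have k1 := kgt0 _ Q2.
have /andP[_ k2] := kpos _ S2; have /andP[_ k3] := kpos _ Q2.
have /andP[c0 c2] := cge0 _ S2; have /andP[c1 c3] := cge0 _ Q2.
have key : (2 * delta)^-1 * ((sel Q).2 - Q.2) ^+ 2 <=
    (u ((sel Q).1, Q.2) - u (sel Q)) + (k Q.2 - k (sel Q).2) * sqd (sel Q).1 Q.1
    + (c Q.2 - c (sel Q).2) by clear -h1; lra.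
have td : `|(sel Q).2 - Q.2| < d.
  rewrite -ltr_sqr ?nnegrE ?(ltW d0)// real_normK ?num_real//.
  apply: le_lt_trans dM.
  have dd : 0 < 2 * delta by exact: mulr_gt0.
  rewrite -ler_pdivrMl//; apply: le_trans key _.
  have := uC _ KS; have := uC _ KS'; rewrite !ler_norml => /andP[H0 H1] /andP[H2 H3].
  have e1 : (k Q.2 - k (sel Q).2) * sqd (sel Q).1 Q.1 <= kM * 1.
    apply: le_trans (_ : k Q.2 * sqd (sel Q).1 Q.1 <= _).
      by rewrite ler_wpM2r//; lra.
    by apply: ler_pM => //; exact: ltW.
  have := ler_norm C; have := ler_norm kM; rewrite /M; clear -c0 c1 c3 e1 H0 H1 H2 H3; lra.
move: td; rewrite !lt_min => /andP[/andP[td1 td2] /andP[td3 tde]].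
have uu : `|u (sel Q) - u ((sel Q).1, Q.2)| < eta / 3.
  by apply: hd1 => //=; rewrite subrr enorm0.
have kk : `|k (sel Q).2 - k Q.2| < eta / 3 by apply: hd2 => //=; rewrite in_itv/=.
have cc : `|c (sel Q).2 - c Q.2| < eta / 3 by apply: hd3 => //=; rewrite in_itv/=.
split; [by []|exact: ltW| |by clear -uu eta0; lra|by split; clear -kk cc eta0; lra].
apply: le_trans key _.
have e1 : (k Q.2 - k (sel Q).2) * sqd (sel Q).1 Q.1 <= eta / 3.
  apply: le_trans (ler_norm _) _; rewrite normrM (ger0_norm D0) distrC.
  apply: le_trans (_ : `|k (sel Q).2 - k Q.2| * 1 <= _); last by lra.
  by rewrite ler_wpM2l.
move: uu cc; rewrite !ltr_norml => /andP[H0 H1] /andP[H2 H3]; clear -e1 H0 H1 H2 H3; lra.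
Qed.

Lemma regularized_lipschitz (u : E -> R) (k k' c c' : R -> R) (xb : V) (rho T C kM : R)
    delta sel rho' s1 s2 :
  tilting u k k' c c' xb rho T C kM ->
  0 < delta -> minimal u k c xb rho T delta sel ->
  exists2 L, 0 < L & forall Q Q', box xb rho' s1 s2 Q -> box xb rho' s1 s2 Q' ->
    `|regularized u k c delta sel Q - regularized u k c delta sel Q'|
      <= L * (enorm (Q.1 - Q'.1) + `|Q.2 - Q'.2|).
Proof.
move=> [T0 rho0 uc uC kder cder k'c c'c kpos kgt0 cge0] d0 hsel.
apply: (infconv_lipschitz (A := kM) rho' s1 s2 hsel (fun S h => h)).
  move=> S [_ S2]; have := kpos _ S2; have := kgt0 _ S2.
  by rewrite /steep => ? /andP[_ ->]; rewrite ltW.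
by rewrite invr_ge0 mulr_ge0// ltW.
Qed.

Lemma C1w_penal (k k' c c' : R -> R) delta (Q : E) :
  (forall s, is_derive s (1 : R) k (k' s)) ->
  (forall s, is_derive s (1 : R) c (c' s)) -> continuous k' -> continuous c' ->
  C1w (fun w : E => - (k w.2 * sqd w.1 Q.1 + (2 * delta)^-1 * (w.2 - Q.2) ^+ 2 + c w.2))
    (diff_of (fun w => - ((2 * k w.2) *: (w.1 - Q.1)))
      (fun w => - (k' w.2 * sqd w.1 Q.1 + 2 * (2 * delta)^-1 * (w.2 - Q.2) + c' w.2))).
Proof.
move=> kder cder k'c c'c.
have hk : C1w (fun w : E => k w.2) (fun z v => k' z.2 * v.2).
  exact: (C1w_comp C1w_snd (fun z => kder z.2) (fun z => k'c z.2)).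
have hc : C1w (fun w : E => c w.2) (fun z v => c' z.2 * v.2).
  exact: (C1w_comp C1w_snd (fun z => cder z.2) (fun z => c'c z.2)).
have h1 := C1w_mul hk (C1w_fst (F := R) (C1w_sq Q.1)).
have h2 : C1w (fun z : E => z.2 - Q.2) (fun z v => v.2 + 0).
  exact: C1w_add C1w_snd (C1w_cst (- Q.2)).
have h3 := C1w_scale (2 * delta)^-1 (C1w_mul h2 h2).
apply: C1w_ext (C1w_scale (-1) (C1w_add (C1w_add h1 h3) hc)) _ _ => [z|z v].
  by rewrite mulN1r expr2.
by rewrite /diff_of dotvNl dotvZl /sqd; ring.
Qed.

(* The differential inequality for [k] and [c] pays for evaluating [H] at the
   base point [Q] instead of the minimizing point [sel Q]. *)
Lemma regularized_subsolution H C1 beta A2 B2 K3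
    (u : E -> R) (k k' c c' : R -> R) (xb : V) (rho T C kM : R) g s1 :
  hamiltonian H C1 beta A2 B2 K3 -> subsolution T H u ->
  tilting u k k' c c' xb rho T C kM ->
  (forall s d, 0 <= s <= T -> 0 <= d ->
    k' s * d ^+ 2 + c' s + C1 * (beta + 2 * k s * d) * d
      + K3 * (k s * d ^+ 2 + c s) <= 0) ->
  0 < g -> 0 < s1 ->
  exists2 eta, 0 < eta & forall delta sel, 0 < delta ->
    minimal u k c xb rho T delta sel -> time_close u k c xb rho T eta delta sel ->
  forall Q P kap r0, box xb rho s1 (T - s1) Q -> 0 < kap -> 0 < r0 ->
    (forall Q', enorm (Q'.1 - Q.1) < r0 -> `|Q'.2 - Q.2| < r0 ->
      regularized u k c delta sel Q'
        - (2 * kap)^-1 * (sqd Q'.1 P.1 + (Q'.2 - P.2) ^+ 2) <=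
      regularized u k c delta sel Q
        - (2 * kap)^-1 * (sqd Q.1 P.1 + (Q.2 - P.2) ^+ 2)) ->
    kap^-1 * (Q.2 - P.2) + H Q.1 Q.2 (regularized u k c delta sel Q)
      (kap^-1 *: (Q.1 - P.1)) <= g.
Proof.
move=> hH usub hT kc_ineq g0 s10.
have [T0 rho0 uc uC kder cder k'c c'c kpos kgt0 cge0] := hT.
have [Hc C10 b0 B20 A20 K30 Hx Hp Hu Hcvx] := hH.
have g8 : 0 < g / 8 by rewrite divr_gt0.
have [d3 d30 hd3] := @hamiltonian_unif_time R n H xb (rho + 3) 0 T C (2 * kM) Hc _ g8.
have K31 : 0 < K3 + 1 by lra.
(* The entries serve, in order, to absorb the time penalty through (H3), to keep the minimizer at
   interior times, and to replace its time by that of [Q] in [H]. *)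
pose eta := Num.min (g / 8 / (K3 + 1)) (Num.min (s1 / 4) (d3 / 2)).
have eta0 : 0 < eta by rewrite !lt_min !divr_gt0.
have etaK : K3 * eta <= g / 8.
  have : eta <= g / 8 / (K3 + 1) by rewrite /eta ge_min lexx.
  by rewrite ler_pdivlMr// => k1; clear -k1 eta0; lra.
have etas : eta <= s1 / 4 by rewrite /eta !ge_min lexx orbT.
have etad : eta <= d3 / 2 by rewrite /eta !ge_min lexx !orbT.
exists eta => // delta sel delta0 hsel hclose Q P kap r0 [Q1 /andP[Q2 Q3]] kap0 r00 touch.
set W := regularized u k c delta sel in touch *.
set p := kap^-1 *: (Q.1 - P.1); set tau := kap^-1 * (Q.2 - P.2).
have [L L0 hL] := regularized_lipschitz (rho + 1) 0 T hT delta0 hsel.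
have [v hv] := @convex_approx_subgradient _ _ (H Q.1 Q.2 (W Q)) _
  (Hp Q.1 Q.2 (W Q)) (Hcvx Q.1 Q.2 (W Q)) p _ g8.
pose ev := enorm v.
have ev0 : 0 <= ev by exact: enorm_ge0.
have ev1 : 0 < ev + 1 by clear -ev0; lra.
pose h0 := Num.min (Num.min (r0 / 2 / (ev + 1)) (1 / (ev + 1))) (Num.min (s1 / 4) (d3 / 4)).
have h00 : 0 < h0 by rewrite !lt_min !divr_gt0.
have kM0 : 0 <= kM.
  have TT : 0 <= (0 : R) <= T by rewrite lexx ltW.
  by have k1 := kgt0 _ TT; have /andP[_ k2] := kpos _ TT; clear -k1 k2; lra.
have kap2 : 0 < (2 * kap)^-1 by rewrite invr_gt0 mulr_gt0.
have idelta : 0 < (2 * delta)^-1 by rewrite invr_gt0 mulr_gt0.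
have vv0 := dotv_ge0 v.
pose M := kM * dotv v v + (2 * delta)^-1 + (2 * kap)^-1 * (dotv v v + 1)
  + C1 * (beta + 2 * kM) * ev + K3 * (L * (ev + 1)).
rewrite -subr_le0; apply: (@le0_of_small _ _ M h0) => // h /andP[hp].
rewrite !le_min => /andP[/andP[hr hv1] /andP[hs hd]].
have hev0 : 0 <= h * ev by rewrite mulr_ge0// ltW.
have hev : h * (ev + 1) <= r0 / 2 by rewrite -ler_pdivlMr.
have hev' : h * (ev + 1) <= 1 by rewrite -ler_pdivlMr.
(* For an inf-convolution the shift goes backward: the minimizer at [Qh] is a competitor at [Q] and
   bounds [W Q - W Qh] from above, while the touching condition bounds it from below. *)
have [Qh QhE1 QhE2] : exists2 Qh : E, Qh.1 = Q.1 - h *: v & Qh.2 = Q.2 - h.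
  by exists (Q.1 - h *: v, Q.2 - h).
have hvn : enorm (h *: v) = h * ev by rewrite enormZ gtr0_norm.
have Qh1 : enorm (Qh.1 - Q.1) = h * ev by rewrite QhE1 addrAC subrr sub0r enormN hvn.
have Qh2 : `|Qh.2 - Q.2| = h by rewrite QhE2 addrAC subrr sub0r normrN gtr0_norm.
have bQ : box xb (rho + 1) 0 T Q.
  by split; [clear -Q1 | apply/andP; split; clear -Q2 Q3 s10]; lra.
have bQh : box xb (rho + 1) 0 T Qh.
  split; last by rewrite QhE2; apply/andP; split; clear -Q2 Q3 s10 hs hp; lra.
  by have := ler_enorm_dist Qh.1 Q.1 xb; clear -Q1 Qh1 hp hev'; lra.
have [[S1 S2] Smin] := hsel Qh.
have [D1 tS penS uS _] := hclose _ bQh.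
have WQh : W Qh = arrival u c (sel Qh) + penal k delta Qh (sel Qh) by [].
have WQ : W Q <= arrival u c (sel Qh) + penal k delta Q (sel Qh).
  by have [_] := hsel Q; apply; split.
move: (sel Qh) S1 S2 Smin D1 tS penS uS WQh WQ => -[y s]/= S1 S2 Smin D1 tS penS uS WQh WQ.
pose d := enorm (y - Qh.1).
have d0 : 0 <= d by exact: enorm_ge0.
have ks0 := kgt0 _ S2; have /andP[_ ksM] := kpos _ S2; have /andP[cs0 _] := cge0 _ S2.
pose pS := (2 * k s) *: (Qh.1 - y).
pose tauS := 2 * (2 * delta)^-1 * (Qh.2 - s).
have tS' : Q.2 - h - s1 / 4 <= s <= Q.2 - h + s1 / 4.
  by move: tS; rewrite QhE2 ler_norml => /andP[k1 k2]; apply/andP; split; clear -k1 k2 etas; lra.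
have bj : tauS - k' s * d ^+ 2 - c' s + H y s (u (y, s)) pS <= 0.
  have t1 : 0 < (y, s).2 < T.
    by move: tS' => /andP[k1 k2]; apply/andP; split => /=; clear -k1 k2 Q2 Q3 s10 hs hp; lra.
  pose phi (w : E) := - (k w.2 * sqd w.1 Qh.1
    + (2 * delta)^-1 * (w.2 - Qh.2) ^+ 2 + c w.2).
  have nmin : \forall w \near ((y, s) : E), u (y, s) - phi (y, s) <= u w - phi w.
    have TB : 0 < Num.min 1 (s1 / 4) by rewrite lt_min ltr01 divr_gt0.
    apply: (box_nbhs (d := Num.min 1 (s1 / 4))) => //= w.
    rewrite !lt_min => /andP[w1 _] /andP[_ w2].
    have bw : box xb (rho + 3) 0 T w.
      split.
        have := ler_enorm_dist w.1 y xb; have := ler_enorm_dist y Qh.1 xb.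
        by have [+ _] := bQh; clear -w1 D1; lra.
      move: w2 tS'; rewrite ltr_norml => /andP[k1 k2] /andP[k3 k4].
      by apply/andP; split; clear -k1 k2 k3 k4 Q2 Q3 s10 hs hp; lra.
    have := Smin _ bw; rewrite /phi /arrival /penal /qpen /steep/=; clear; lra.
  have := barron_jensen hH uc usub (C1w_penal delta Qh kder cder k'c c'c) t1 nmin.
  rewrite /=.
  have -> : - (2 * k s *: (y - Qh.1)) = pS by rewrite /pS -scalerN opprB.
  by rewrite sqdE -/d /tauS; clear; lra.
have step : h * (dotv v p + tau) <= h * (dotv v pS + tauS)
    + h ^+ 2 * (kM * dotv v v + (2 * delta)^-1 + (2 * kap)^-1 * (dotv v v + 1)).
  have : enorm (Qh.1 - Q.1) < r0 by rewrite Qh1; clear -hev hp r00; lra.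
  have : `|Qh.2 - Q.2| < r0 by rewrite Qh2; clear -hev hev0 hp r00; lra.
  move=> k2 k1; have := touch Qh k1 k2.
  have -> : (2 * kap)^-1 * (sqd Qh.1 P.1 + (Qh.2 - P.2) ^+ 2) =
     (2 * kap)^-1 * (sqd Q.1 P.1 + (Q.2 - P.2) ^+ 2) - h * (dotv v p + tau)
     + h ^+ 2 * ((2 * kap)^-1 * (dotv v v + 1)).
    rewrite QhE1 QhE2 -scaleNr sqdD /p /tau dotvZr; field.
    by rewrite gt_eqF.
  have -> : h ^+ 2 * (kM * dotv v v + (2 * delta)^-1 + (2 * kap)^-1 * (dotv v v + 1))
    = h ^+ 2 * (kM * dotv v v) + h ^+ 2 * (2 * delta)^-1
      + h ^+ 2 * ((2 * kap)^-1 * (dotv v v + 1)) by ring.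
  have : penal k delta Q (y, s) - penal k delta Qh (y, s) = h * (dotv v pS + tauS)
      + h ^+ 2 * (k s * dotv v v) + h ^+ 2 * (2 * delta)^-1.
    have e1 : Q.1 = Qh.1 + h *: v by rewrite QhE1 subrK.
    have e2 : Q.2 = Qh.2 + h by rewrite QhE2 subrK.
    rewrite /penal /qpen /steep (sqdC _ Q.1) e1 e2 sqdD (sqdC _ Qh.1) /pS /tauS dotvZr/=.
    by ring.
  have kv : h ^+ 2 * (k s * dotv v v) <= h ^+ 2 * (kM * dotv v v).
    by apply: ler_wpM2l; [exact: sqr_ge0 | exact: ler_wpM2r].
  by clear -kv WQ WQh; lra.
have {}step : dotv v p + tau <= dotv v pS + tauS
    + h * (kM * dotv v v + (2 * delta)^-1 + (2 * kap)^-1 * (dotv v v + 1)).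
  rewrite -(ler_pM2l hp); apply: le_trans step _.
  by rewrite le_eqVlt; apply/orP; left; apply/eqP; ring.
have cvx := hv pS; rewrite dotvDr dotvNr in cvx.
have pSn : enorm pS = 2 * k s * d.
  by rewrite enormZ gtr0_norm ?mulr_gt0// enormB.
have pSM : enorm pS <= 2 * kM.
  rewrite pSn; apply: le_trans (_ : 2 * kM * 1 <= _); last by clear; lra.
  apply: ler_pM => //; last by rewrite ler_pM2l.
  by rewrite mulr_ge0// ltW.
have sh1 : H Q.1 Q.2 (W Q) pS - H y Q.2 (W Q) pS <=
    C1 * (beta + 2 * k s * d) * d + h * (C1 * (beta + 2 * kM) * ev).
  have := Hx Q.2 (W Q) pS Q.1 y; rewrite ler_norml => /andP[_ k1].
  apply: le_trans k1 _; rewrite pSn.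
  have k2 : enorm (Q.1 - y) <= d + h * ev.
    by have := ler_enorm_dist Q.1 Qh.1 y; rewrite (enormB Q.1 Qh.1) Qh1 (enormB Qh.1 y) -/d; clear; lra.
  have c0 : 0 <= C1 * (beta + 2 * k s * d).
    by rewrite -pSn mulr_ge0// addr_ge0// enorm_ge0.
  apply: le_trans (ler_wpM2l c0 k2) _; rewrite mulrDr lerD2l mulrCA.
  apply: ler_wpM2l; first exact: ltW.
  by apply: ler_wpM2r => //; apply: ler_wpM2l => //; rewrite -pSn lerD2l.
have sh2 : H y Q.2 (W Q) pS - H y Q.2 (u (y, s)) pS <=
    K3 * (k s * d ^+ 2 + c s) + g / 8 + h * (K3 * (L * (ev + 1))).
  have := Hu y Q.2 pS (W Q) (u (y, s)); rewrite ler_norml => /andP[_ k1].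
  apply: le_trans k1 _.
  have k2 : `|W Q - u (y, s)| <= k s * d ^+ 2 + c s + eta + L * (h * (ev + 1)).
    have k3 : `|W Q - W Qh| <= L * (h * (ev + 1)).
      apply: le_trans (hL _ _ bQ bQh) _.
      by rewrite (enormB Q.1 Qh.1) Qh1 (distrC Q.2) Qh2 (_ : h * ev + h = h * (ev + 1)) ?lexx//; ring.
    have k4 : W Qh - u (y, s) = k s * d ^+ 2 + c s + (2 * delta)^-1 * (s - Qh.2) ^+ 2.
      by rewrite WQh /arrival /penal /qpen /steep/= sqdE -/d; ring.
    have k5 : 0 <= (2 * delta)^-1 * (s - Qh.2) ^+ 2.
      by rewrite mulr_ge0 ?sqr_ge0// ltW.
    have k6 : 0 <= k s * d ^+ 2 by rewrite mulr_ge0 ?sqr_ge0// ltW.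
    rewrite -/(Qh.2) in penS.
    move: k3; rewrite !ler_norml => /andP[k7 k8]; apply/andP; split; clear -k4 k5 k6 k7 k8 cs0 penS eta0 L0 hp ev0; lra.
  apply: le_trans (ler_wpM2l K30 k2) _.
  have -> : K3 * (k s * d ^+ 2 + c s + eta + L * (h * (ev + 1))) =
    K3 * (k s * d ^+ 2 + c s) + K3 * eta + h * (K3 * (L * (ev + 1))) by ring.
  by clear -etaK; lra.
have sh3 : H y Q.2 (u (y, s)) pS - H y s (u (y, s)) pS < g / 8.
  have ts : `|Q.2 - s| < d3.
    have := ler_distD Qh.2 Q.2 s; rewrite (distrC Q.2 Qh.2) Qh2 (distrC Qh.2 s).
    by have : `|s - Qh.2| <= eta by []; clear -etad hd hp d30; lra.
  have by' : box xb (rho + 3) 0 T (y, Q.2).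
    by split => //; apply/andP; split => /=; clear -Q2 Q3 s10; lra.
  have := hd3 _ _ _ _ _ by' (uC _ (conj S1 S2 : box _ _ _ _ (y, s))) pSM ts.
  by rewrite ltr_norml => /andP[].
have kc := kc_ineq _ _ S2 d0.
have -> : h * M = h * (kM * dotv v v + (2 * delta)^-1 + (2 * kap)^-1 * (dotv v v + 1))
  + h * (C1 * (beta + 2 * kM) * ev) + h * (K3 * (L * (ev + 1))).
  by rewrite /M; ring.
by clear -g0 kc step cvx sh1 sh2 sh3 bj; lra.
Qed.

End Regularization.

(** * Comparison in a cone of propagation *)

Section ConeComparison.
Context {R : realType} {n : nat}.
Notation V := 'rV[R]_n.
Notation E := (V * R)%type.

(** Regularizes the distance at its vertex, so that functions of it are C1 test functions with
    spatial slope at most 1. *)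
Definition smooth_dist (xb : V) (eta : R) (x : V) : R :=
  Num.sqrt (sqd x xb + eta ^+ 2).

(** With [b = B2 / A2 + |xb|] and [eta -> 0], the condition that [(xb, t)] has height below
    [b + rho] becomes [b (exp(A2 t) - 1) < rho], whose left side is [Rfun A2 B2 xb t]. *)
Definition cone_height (A2 b eta : R) (xb : V) (P : E) : R :=
  (smooth_dist xb eta P.1 + b) * expR (A2 * P.2).

(** A large [N] makes this dominate on the lateral boundary of the cone relative to its value at
    [(xb, tb)]; [lam] produces the zeroth-order growth that (H3) consumes. *)
Definition barrier (lam N A2 b eta : R) (xb : V) (P : E) : R :=
  expR (lam * P.2 + N * cone_height A2 b eta xb P).

Lemma enorm_smooth_dist xb eta x : enorm (x - xb) <= smooth_dist xb eta x.
Proof. by apply: ler_wsqrtr; rewrite lerDl sqr_ge0. Qed.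

Lemma smooth_dist_gt0 xb eta x : 0 < eta -> 0 < smooth_dist xb eta x.
Proof. by move=> e0; rewrite sqrtr_gt0 ltr_wpDl ?sqd_ge0// exprn_gt0. Qed.

Lemma eta_le_smooth_dist xb eta x : 0 < eta -> eta <= smooth_dist xb eta x.
Proof.
move=> e0; rewrite -[leLHS]gtr0_norm// -sqrtr_sqr; apply: ler_wsqrtr.
by rewrite lerDr sqd_ge0.
Qed.

Lemma smooth_distxx xb eta : 0 < eta -> smooth_dist xb eta xb = eta.
Proof. by move=> e0; rewrite /smooth_dist sqdxx add0r sqrtr_sqr gtr0_norm. Qed.

Lemma C1w_smooth_dist xb eta : 0 < eta ->
  C1w (smooth_dist xb eta) (fun x v => (smooth_dist xb eta x)^-1 * dotv (x - xb) v).
Proof.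
move=> e0.
have h := C1w_add (C1w_sq xb) (C1w_cst (eta ^+ 2)).
have pos x : 0 < dotv (x - xb) (x - xb) + eta ^+ 2.
  by rewrite ltr_wpDl ?dotv_ge0// exprn_gt0.
apply: C1w_ext (C1w_comp (g' := fun r => (2 * Num.sqrt r)^-1) h
    (fun x => is_derive1_sqrt (pos x)) _) _ _ => // x.
  apply: cvgV; first by rewrite mulf_neq0// gt_eqF// sqrtr_gt0.
  by apply: cvgM; [exact: cvg_cst | exact: sqrt_continuous].
move=> v; rewrite addr0 /smooth_dist /sqd invfM; field.
by rewrite gt_eqF// sqrtr_gt0.
Qed.

Lemma C1w_exp {E' : normedModType R} (f : E' -> R) df : C1w f df ->
  C1w (fun z => expR (f z)) (fun z v => expR (f z) * df z v).
Proof.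
move=> h; apply: (C1w_comp h) => z; exact: continuous_expR.
Qed.

Lemma C1w_cone_height A2 b eta xb : 0 < eta ->
  C1w (cone_height A2 b eta xb)
    (diff_of (fun P => (expR (A2 * P.2) / smooth_dist xb eta P.1) *: (P.1 - xb))
       (fun P => A2 * cone_height A2 b eta xb P)).
Proof.
move=> e0.
have h1 := C1w_add (C1w_fst (F := R) (C1w_smooth_dist xb e0)) (C1w_cst b).
have h2 := C1w_exp (C1w_scale A2 (C1w_snd (E := 'rV[R]_n))).
apply: C1w_ext (C1w_mul h1 h2) _ _ => // z v.
by rewrite /diff_of /cone_height dotvZl; ring.
Qed.

Lemma C1w_barrier lam N A2 b eta xb : 0 < eta ->
  C1w (barrier lam N A2 b eta xb)
    (diff_of (fun P => (barrier lam N A2 b eta xb P * N *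
         (expR (A2 * P.2) / smooth_dist xb eta P.1)) *: (P.1 - xb))
       (fun P => barrier lam N A2 b eta xb P *
         (lam + N * (A2 * cone_height A2 b eta xb P)))).
Proof.
move=> e0.
have h := C1w_add (C1w_scale lam (C1w_snd (E := 'rV[R]_n)))
  (C1w_scale N (C1w_cone_height A2 b xb e0)).
apply: C1w_ext (C1w_exp h) _ _ => // z v.
by rewrite /diff_of /barrier !dotvZl; ring.
Qed.

(* The level sets of the cone height move at least as fast as the largest
   characteristic speed, so the barrier absorbs the gradient dependence of H. *)
Lemma barrier_speed lam N A2 B2 eta xb (P : E) (b := B2 / A2 + enorm xb) :
  0 < eta -> 0 < A2 -> 0 <= B2 -> 0 <= N ->
  (A2 * enorm P.1 + B2) * enorm ((barrier lam N A2 b eta xb P * N *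
         (expR (A2 * P.2) / smooth_dist xb eta P.1)) *: (P.1 - xb)) <=
  barrier lam N A2 b eta xb P * (N * (A2 * cone_height A2 b eta xb P)).
Proof.
move=> e0 A20 B20 N0.
set B := barrier _ _ _ _ _ _ _; set e := expR (A2 * P.2); set D := smooth_dist _ _ _.
have B0 : 0 < B by exact: expR_gt0.
have ee0 : 0 < e by exact: expR_gt0.
have D0 : 0 < D by exact: smooth_dist_gt0.
have c0 : 0 <= B * N * e by rewrite !mulr_ge0// ltW.
rewrite enormZ ger0_norm; last by rewrite mulrA divr_ge0// ltW.
have le1 : A2 * enorm P.1 + B2 <= A2 * (D + b).
  have -> : A2 * (D + b) = A2 * D + B2 + A2 * enorm xb.
    by rewrite /b; field; rewrite gt_eqF.
  have : A2 * enorm P.1 <= A2 * (D + enorm xb).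
    rewrite ler_pM2l//; have := ler_enormD (P.1 - xb) xb; rewrite subrK => h.
    by apply: le_trans h _; rewrite lerD2r enorm_smooth_dist.
  by clear; lra.
have -> : B * (N * (A2 * cone_height A2 b eta xb P)) = A2 * (D + b) * (B * N * e).
  by rewrite /cone_height -/D -/e; ring.
apply: ler_pM => //.
- by rewrite addr_ge0// mulr_ge0 ?enorm_ge0// ltW.
- by rewrite mulr_ge0 ?enorm_ge0// mulrA divr_ge0// ltW.
have -> : B * N * (e / D) * enorm (P.1 - xb) = B * N * e * (enorm (P.1 - xb) / D).
  by ring.
rewrite -[leRHS]mulr1; apply: ler_wpM2l => //.
by rewrite ler_pdivrMr// mul1r enorm_smooth_dist.
Qed.

Lemma expR_large (X d : R) : 0 < d -> exists2 N, 0 <= N & X < expR (N * d).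
Proof.
move=> d0; exists (`|X| / d); first by rewrite divr_ge0// ltW.
rewrite divfK ?gt_eqF//; apply: le_lt_trans (ler_norm X) _.
by apply: lt_le_trans (expR_ge1Dx _); rewrite ltrDr.
Qed.

(** For an [L]-Lipschitz function the doubled points are at distance of order [kap], so the slope,
    distance over [kap], is at most [4 * L] for every [kap]. *)
Lemma doubling_estimate (a b kap L : R) : 0 <= a -> 0 <= b -> 0 < kap -> 0 < L ->
  (2 * kap)^-1 * (a ^+ 2 + b ^+ 2) <= L * (a + b) -> a + b <= 4 * kap * L.
Proof.
move=> a0 b0 k0 L0; rewrite ler_pdivrMl ?mulr_gt0// => h.
have [e|ne] := eqVneq (a + b) 0.
  by rewrite e !mulr_ge0// ltW.
have ab0 : 0 < a + b by rewrite lt_neqAle eq_sym ne addr_ge0.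
rewrite -(ler_pM2r ab0); have := sqr_ge0 (a - b); lra.
Qed.

(** The comparison is stated at the vertex [(xb, tb)] and through a witness [y], because the
    unregularized inf-convolution is never formed. If it fails, the time-regularized [W] exceeds [u]
    there by a fixed margin, which the barrier argument excludes. *)
Theorem cone_comparison H C1 beta A2 B2 K3 (u : E -> R) (k k' c c' : R -> R)
    (xb : V) (rho T C kM tb T1 eta s0 : R) (b := B2 / A2 + enorm xb) :
  hamiltonian H C1 beta A2 B2 K3 -> subsolution T H u -> supersolution T H u ->
  0 < A2 -> tilting u k k' c c' xb (rho + 1) T C kM ->
  (forall s d, 0 <= s <= T -> 0 <= d ->
    k' s * d ^+ 2 + c' s + C1 * (beta + 2 * k s * d) * d
      + K3 * (k s * d ^+ 2 + c s) <= 0) ->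
  0 < tb -> T1 < T -> 0 < eta -> 0 <= rho -> 0 < s0 ->
  (eta + b) * expR (A2 * tb) < b + rho -> b + rho <= (eta + b) * expR (A2 * T1) ->
  (forall x t, enorm (x - xb) <= rho -> 0 <= t <= s0 -> t <= T ->
    exists2 y, enorm (y - xb) <= rho + 4 & u (y, t) + k t * sqd y x + c t <= u (x, t)) ->
  exists2 y, enorm (y - xb) <= rho + 4 &
    u (y, tb) + k tb * sqd y xb + c tb <= u (xb, tb).
Proof.
move=> hH usub usup A20 hT kc tb0 T1T eta0 rho0 s00 ztb zT1 init.
have [Hc C10 beta0 B20 _ K30 Hx Hp Hu Hcvx] := hH.
have [T0 _ uc uC kder cder k'c c'c kpos kgt0 cge0] := hT.
apply: contrapT => nex.
have bge0 : 0 <= b by rewrite addr_ge0 ?enorm_ge0// divr_ge0// ltW.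
have etab : 0 < eta + b by rewrite ltr_pwDl.
pose Z := cone_height A2 b eta xb; pose Zm := b + rho.
(* The cone closes by time [T1 < T], so no maximum can occur at the terminal time. *)
have ZT1 (P : E) : Z P <= Zm -> P.2 <= T1.
  move=> ZP; rewrite -(ler_pM2l A20) -ler_expR -(ler_pM2l etab).
  apply: le_trans zT1; apply: le_trans ZP; rewrite /Z /cone_height.
  by rewrite ler_pM2r ?expR_gt0// lerD2r eta_le_smooth_dist.
have Zge (P : E) : 0 <= P.2 -> enorm (P.1 - xb) + b <= Z P.
  move=> P2; rewrite /Z /cone_height -[leLHS]mulr1; apply: ler_pM => //.
  - by rewrite addr_ge0// enorm_ge0.
  - by rewrite lerD2r enorm_smooth_dist.
  - by rewrite -expR0 ler_expR mulr_ge0// ltW.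
pose Pb : E := (xb, tb).
have ZPb : Z Pb < Zm by rewrite /Z /cone_height smooth_distxx.
have tbT1 : tb <= T1 by exact: (ZT1 Pb (ltW ZPb)).
pose D := box xb rho 0 T `&` [set P | Z P <= Zm].
have DP (P : E) : 0 <= P.2 -> Z P <= Zm -> D P.
  move=> P2 ZP; split => //; split; last first.
    by rewrite P2/=; apply: le_trans (ZT1 _ ZP) _; exact: ltW.
  by have := Zge _ P2; rewrite /Zm in ZP; clear -ZP; lra.
have Zc : continuous Z by exact: C1w_continuous (C1w_cone_height A2 b xb eta0).
have Dc : compact D.
  apply: compact_closedI; first exact: box_compact.
  exact: (closed_comp (fun P _ => Zc P) (@closed_le _ Zm)).
pose fail y := (u (y, tb) + k tb * sqd y xb + c tb) - u (xb, tb).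
have tbT : 0 <= tb <= T by rewrite ltW//=; apply: le_trans tbT1 _; exact: ltW.
(* The negated conclusion gives positivity for each [y] separately; compactness turns it into one
   margin, half of which survives the regularization in time. *)
have [m0 m00 hm0] : exists2 m0, 0 < m0 & forall y, enorm (y - xb) <= rho + 4 -> m0 <= fail y.
  have fc : continuous fail.
    apply: contD; last exact: cont_cst.
    apply: contD; last exact: cont_cst.
    apply: contD.
      apply: (cont_comp (f := fun y : V => (y, tb)) _ uc).
      by apply: (cont_pair (f := id)) => y; [exact: cvg_id | exact: cst_continuous].
    by apply: contM; [exact: cont_cst | exact: sqd_continuous].
  have [|y hy ymin] := compact_argmin _ (@eball_compact _ _ xb (rho + 4)) fc.
    by exists xb; rewrite /= subrr enorm0; clear -rho0; lra.
  exists (fail y) => //; rewrite /fail subr_gt0 ltNge; apply/negP => hle.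
  by apply: nex; exists y.
pose m := m0 / 2.
have mgt0 : 0 < m by rewrite divr_gt0.
pose Cm := 2 * C + kM + 1.
have bPb : box xb (rho + 1) 0 T Pb.
  by split => //=; rewrite subrr enorm0; clear -rho0; lra.
have rho14 : rho + 1 + 3 = rho + 4 by clear; lra.
have Cge0 : 0 <= C.
  apply: le_trans (uC Pb _); first exact: normr_ge0.
  by split => //=; rewrite subrr enorm0 rho14; clear -rho0; lra.
have kMge0 : 0 <= kM by have /andP[k1 k2] := cge0 _ tbT; clear -k1 k2; lra.
have Cm0 : 0 < Cm by rewrite /Cm; clear -Cge0 kMge0; lra.
(* The part [K3] pays for (H3) on [W Q - u P]; the part 1 leaves a surplus [mu * B P >= 4 * e0]
   against three errors of size [e0]. *)
pose lam := K3 + 1.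
have dZ : 0 < Zm - Z Pb by rewrite subr_gt0.
have [N N0 hN] := expR_large (Cm * expR (lam * tb) / m) dZ.
pose B := barrier lam N A2 b eta xb.
have Bgt0 P : 0 < B P by exact: expR_gt0.
have lam0 : 0 <= lam by rewrite /lam; clear -K30; lra.
have Bge1 (P : E) : 0 <= P.2 -> 1 <= B P.
  move=> P2; have Z0 : 0 <= Z P.
    by apply: le_trans (Zge _ P2); rewrite addr_ge0// enorm_ge0.
  by rewrite -expR0 ler_expR; apply: addr_ge0; exact: mulr_ge0.
have Blat (P : E) : 0 <= P.2 -> Zm <= Z P -> Cm * B Pb < m * B P.
  move=> P2 ZP.
  have h1 : expR (N * Zm) <= B P.
    rewrite ler_expR; apply: le_trans (_ : N * Z P <= _); first exact: ler_wpM2l.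
    by rewrite lerDr mulr_ge0.
  apply: lt_le_trans (_ : m * expR (N * Zm) <= _); last by rewrite ler_pM2l.
  have -> : B Pb = expR (lam * tb) * expR (N * Z Pb) by rewrite -expRD.
  have -> : N * Zm = N * (Zm - Z Pb) + N * Z Pb by ring.
  rewrite expRD !mulrA ltr_pM2r ?expR_gt0//.
  by move: hN; rewrite ltr_pdivrMr// (mulrC _ m).
pose e0 := m / (4 * B Pb).
have e00 : 0 < e0 by apply: divr_gt0 => //; exact: mulr_gt0.
have e0B : m / B Pb = 4 * e0 by rewrite /e0; field; rewrite gt_eqF.
pose s1 := Num.min (s0 / 2) ((T - T1) / 2).
have s10 : 0 < s1 by rewrite lt_min !divr_gt0// subr_gt0.
have s1s0 : s1 <= s0 / 2 by rewrite /s1 ge_min lexx.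
have s1T : s1 <= (T - T1) / 2 by rewrite /s1 ge_min lexx orbT.
have [et et0 hsubW] := regularized_subsolution hH usub hT kc e00 s10.
pose et' := Num.min et (m0 / 6).
have et'0 : 0 < et' by rewrite lt_min et0 divr_gt0.
have [delta delta0 hdelta] := time_close_exists hT et'0.
have [sel hsel] := regularized_exists delta hT.
have hclose := hdelta _ hsel.
have hclose' : time_close u k c xb (rho + 1) T et delta sel.
  have le1 : et' <= et by rewrite /et' ge_min lexx.
  move=> Q /hclose[q1 q2 q3 q4 [q5 q6]].
  by split; [|exact: le_trans le1|exact: le_trans le1|exact: le_trans le1|
    split; exact: le_trans le1].
pose W := regularized u k c delta sel.
have {}hsubW := hsubW delta sel delta0 hsel hclose'.
have WPb : m <= W Pb - u Pb.
  have bPb' : box xb (rho + 1 + 1) 0 T Pb.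
    by split => //=; rewrite subrr enorm0; clear -rho0; lra.
  have [q1 q2 q3 q4 [q5 q6]] := hclose _ bPb'.
  have [[S1 S2] _] := hsel Pb; rewrite rho14 in S1.
  have := hm0 _ S1; rewrite /fail /W /regularized /arrival /penal /qpen /steep.
  have p0 : 0 <= (2 * delta)^-1 * ((sel Pb).2 - Pb.2) ^+ 2.
    by rewrite mulr_ge0 ?sqr_ge0// invr_ge0 mulr_ge0// ltW.
  have et6 : et' <= m0 / 6 by rewrite /et' ge_min lexx orbT.
  have d1 : sqd (sel Pb).1 xb <= 1 by rewrite sqdE expr_le1// enorm_ge0.
  have kd : (k tb - k (sel Pb).2) * sqd (sel Pb).1 xb <= et'.
    apply: le_trans (ler_norm _) _; rewrite normrM (ger0_norm (sqd_ge0 _ _)) distrC.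
    rewrite -[leRHS]mulr1; apply: ler_pM => //; exact: sqd_ge0.
  move: q4 q6; rewrite !ler_norml => /andP[q4 _] /andP[q6 _]; move: q4 q6 p0 kd et6.
  rewrite -[Pb.1]/xb -[Pb.2]/tb /m -/Pb; clear; lra.
have Wle (P : E) : box xb (rho + 4) 0 T P -> W P <= C + kM.
  move=> bP; have [_] := hsel P; rewrite rho14 => /(_ _ bP).
  rewrite /W /regularized /penal /qpen /arrival sqdxx subrr expr0n/= !mulr0 !addr0.
  move=> h; apply: le_trans h _; have [_ /cge0/andP[_ c1]] := bP.
  by rewrite -rho14 in bP; have := uC _ bP; rewrite ler_norml => /andP[_ u1]; exact: lerD.
have [L L0 hL] := regularized_lipschitz (rho + 1) 0 T hT delta0 hsel.
(* The slope bound [4 * L] holds for every [kap], so this time modulus can be fixed before [kap]. *)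
have [d3 d30 hd3] := @hamiltonian_unif_time R n H xb (rho + 1) 0 T C (4 * L) Hc _ e00.
pose nu := Num.min (1 / 2) (Num.min (s1 / 2) (d3 / 2)).
have nu0 : 0 < nu by rewrite !lt_min !divr_gt0.
pose err := C1 * beta * (4 * L) + C1 * (8 * L ^+ 2) + K3 * (4 * L ^+ 2) + 4 * L ^+ 2.
have LL0 : 0 <= L ^+ 2 by exact: sqr_ge0.
have err0 : 0 <= err by rewrite !addr_ge0// ?mulr_ge0// ltW.
have err1 : 0 < err + 1 by clear -err0; lra.
pose kap := Num.min (nu / (4 * L)) (e0 / (err + 1)).
have L4 : 0 < 4 * L by exact: mulr_gt0.
have kap0 : 0 < kap.
  rewrite lt_min; apply/andP; split; apply: divr_gt0;
    [exact: nu0 | exact: L4 | exact: e00 | exact: err1].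
have kapnu : 4 * kap * L <= nu.
  have : kap <= nu / (4 * L) by rewrite /kap ge_min lexx.
  by rewrite ler_pdivlMr//; apply: le_trans; rewrite mulrAC mulrC (mulrC 4) mulrA.
have kaperr : kap * err <= e0.
  apply: le_trans (_ : kap * (err + 1) <= _).
    by rewrite ler_pM2l//; clear; lra.
  by rewrite -ler_pdivlMr// /kap ge_min lexx orbT.
pose pen (Q P : E) := (2 * kap)^-1 * (sqd Q.1 P.1 + (Q.2 - P.2) ^+ 2).
have ikap : 0 < (2 * kap)^-1 by rewrite invr_gt0 mulr_gt0.
have pen0 Q P : 0 <= pen Q P.
  by rewrite mulr_ge0 ?addr_ge0 ?sqd_ge0 ?sqr_ge0// ltW.
have penxx Q : pen Q Q = 0 by rewrite /pen sqdxx subrr expr0n/= addr0 mulr0.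
have KQc : compact (box xb (rho + 1) 0 T `*` D).
  by apply: compact_setX => //; exact: box_compact.
have Wc : continuous W.
  apply: (@box_lipschitz_continuous _ _ _ xb) => r t1 t2.
  exact: regularized_lipschitz hT delta0 hsel.
(* The maximum of the quotient is the least [mu] with [W - u - pen <= mu * B]. Only the second point
   is confined to the cone; the first ranges over a larger box and so stays interior to it. *)
pose Theta (z : E * E) := (W z.1 - u z.2 - pen z.1 z.2) / B z.2.
have fc : continuous (fst : E * E -> E) by move=> z; exact: cvg_fst.
have sc : continuous (snd : E * E -> E) by move=> z; exact: cvg_snd.
have Bc : continuous B by exact: C1w_continuous (C1w_barrier lam N A2 b xb eta0).
have Thetac : continuous Theta.
  have penc : continuous (fun z : E * E => pen z.1 z.2).
    have ci i : continuous (fun y : V => y 0 i) by exact: C1w_continuous (C1w_coord i).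
    have c1 : continuous (fun x : E => x.1) by move=> z; exact: cvg_fst.
    have c2 : continuous (fun x : E => x.2) by move=> z; exact: cvg_snd.
    have h1 i : continuous (fun z : E * E => z.1.1 0 i - z.2.1 0 i).
      apply: contD; first exact: (cont_comp fc (cont_comp c1 (ci i))).
      apply: contN; exact: (cont_comp sc (cont_comp c1 (ci i))).
    have h2 : continuous (fun z : E * E => z.1.2 - z.2.2).
      by apply: contD; [exact: (cont_comp fc c2) | apply: contN; exact: (cont_comp sc c2)].
    apply: contM; first exact: cont_cst.
    apply: contD; last exact: (contM h2 h2).
    rewrite (_ : (fun _ => _) = fun z : E * E =>
        \sum_i (z.1.1 0 i - z.2.1 0 i) * (z.1.1 0 i - z.2.1 0 i)).
      exact: (cont_sum (fun i => contM (h1 i) (h1 i))).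
    by apply/funext => z; apply: eq_bigr => i _; rewrite !mxE.
  have ic : continuous (fun z : E * E => (B z.2)^-1).
    move=> z; apply: cvgV; first by rewrite gt_eqF.
    exact: (cont_comp sc Bc).
  apply: (contM _ ic); apply: contD; last exact: contN.
  by apply: contD; [exact: (cont_comp fc Wc) | apply: contN; exact: (cont_comp sc uc)].
have DPb : D Pb by apply: DP => /=; exact: ltW.
have [[Q P] [/= KQ KP] hmax] := compact_argmax (ex_intro _ (Pb, Pb) (conj bPb DPb)) KQc Thetac.
pose mu := Theta (Q, P).
have WQP : W Q - u P - pen Q P = mu * B P by rewrite /mu /Theta/= divfK// gt_eqF.
have mule Q' P' : box xb (rho + 1) 0 T Q' -> D P' -> W Q' - u P' - pen Q' P' <= mu * B P'.
  by move=> bQ' DP'; rewrite -ler_pdivrMr//; exact: (hmax (Q', P') (conj bQ' DP')).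
have mum : m <= mu * B Pb.
  by have := mule _ _ bPb DPb; rewrite penxx subr0; exact: le_trans.
have mu0 : 4 * e0 <= mu by rewrite -e0B ler_pdivrMr.
have mugt0 : 0 < mu by clear -mu0 e00; lra.
have [[P1 /andP[P2 P3]] /= ZP] := KP; have [Q1 Q2] := KQ.
have bP : box xb (rho + 1) 0 T P by split; [clear -P1; lra | rewrite P2].
have muBe : 4 * e0 <= mu * B P.
  by apply: le_trans mu0 _; rewrite -[leLHS]mulr1 ler_pM2l// Bge1.
pose a := enorm (Q.1 - P.1); pose a' := `|Q.2 - P.2|.
have age0 : 0 <= a by exact: enorm_ge0.
have a'ge0 : 0 <= a' by exact: normr_ge0.
have penE : pen Q P = (2 * kap)^-1 * (a ^+ 2 + a' ^+ 2).
  by rewrite /pen sqdE -/a /a' real_normK ?num_real.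
have QP := hL _ _ KQ bP; rewrite -/W -/a -/a' in QP.
(* The competitor [(P, P)] has the same denominator [B P], so the penalty is at most [W Q - W P]. *)
have penL : pen Q P <= L * (a + a').
  have := mule _ _ bP KP; rewrite penxx -WQP subr0.
  by move: QP; rewrite ler_norml => /andP[_]; clear; lra.
have aa' : a + a' <= 4 * kap * L by apply: doubling_estimate => //; rewrite -penE.
have penle : pen Q P <= kap * (4 * L ^+ 2).
  apply: le_trans penL _; rewrite (_ : kap * _ = L * (4 * kap * L)); last by ring.
  by rewrite ler_pM2l.
have aanu : a + a' <= nu by exact: le_trans aa' kapnu.
have [anu a'nu] : a <= nu /\ a' <= nu by split; clear -age0 a'ge0 aanu; lra.
have nuh : nu <= 1 / 2 by rewrite /nu ge_min lexx.
have nus : nu <= s1 / 2 by rewrite /nu !ge_min lexx !orbT.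
have nud : nu <= d3 / 2 by rewrite /nu !ge_min lexx !orbT.
have C1b0 : 0 <= C1 * beta by exact: mulr_ge0.
have errE : kap * err = C1 * beta * (4 * kap * L) + C1 * (2 * (kap * (4 * L ^+ 2)))
   + K3 * (kap * (4 * L ^+ 2)) + kap * (4 * L ^+ 2) by rewrite /err; ring.
have k4 : 0 <= kap * (4 * L ^+ 2) by rewrite !mulr_ge0// ltW.
have t1 : 0 <= C1 * beta * (4 * kap * L) by rewrite !mulr_ge0// ltW.
have t2 : 0 <= C1 * (2 * (kap * (4 * L ^+ 2))) by rewrite !mulr_ge0// ltW.
have t3 : 0 <= K3 * (kap * (4 * L ^+ 2)) by rewrite !mulr_ge0// ltW.
(* On the lateral boundary [mu * B P] would exceed any value that [W - u] can take. *)
have ZPm : Z P < Zm.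
  rewrite ltNge; apply/negP => ZmP; have := Blat _ P2 ZmP; rewrite ltNge => /negP; apply.
  apply: le_trans (_ : mu * B Pb * B P <= _); first by rewrite ler_pM2r.
  rewrite mulrAC -WQP ler_pM2r//.
  have W1 : W Q <= C + kM.
    by apply: Wle; split => //; apply: le_trans Q1 _; clear; lra.
  have u1 : - C <= u P.
    have : box xb (rho + 1 + 3) 0 T P by split; [clear -P1; lra | rewrite P2].
    by move=> /uC; rewrite ler_norml => /andP[].
  by rewrite /Cm; have := pen0 Q P; clear -W1 u1; lra.
(* At times up to [s0] the initial comparison gives [W P <= u P], and the Lipschitz bound leaves at
   most [e0] for [W Q - u P], against [mu * B P >= 4 * e0]. *)
have P2s0 : s0 < P.2.
  rewrite ltNge; apply/negP => Ps0.
  have Pt : 0 <= P.2 <= s0 by rewrite P2.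
  have [y y1 y2] := init P.1 P.2 P1 Pt P3.
  have WP : W P <= u P.
    have [_] := hsel P; rewrite rho14 => /(_ (y, P.2) _) h.
    apply: le_trans (h _) _; first by split => //=; rewrite P2.
    rewrite /arrival /penal /qpen /steep/= subrr expr0n/= mulr0 addr0.
    by move: y2; rewrite -surjective_pairing; clear; lra.
  have L4' : L * (a + a') <= kap * (4 * L ^+ 2).
    by rewrite (_ : kap * _ = L * (4 * kap * L)); [rewrite ler_pM2l | ring].
  move: QP; rewrite ler_norml => /andP[_ QP1]; have := pen0 Q P.
  by clear -QP1 WP L4' t1 t2 t3 errE kaperr muBe WQP e00; lra.
have PT1 : P.2 <= T1 by exact: ZT1.
pose p := kap^-1 *: (Q.1 - P.1); pose tau := kap^-1 * (Q.2 - P.2).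
have bQ : box xb (rho + 1) s1 (T - s1) Q.
  split => //; move: a'nu; rewrite /a' ler_norml => /andP[z1 z2].
  by apply/andP; split; clear -z1 z2 nus s1s0 s1T P2s0 PT1 s00 s10; lra.
have subQ : tau + H Q.1 Q.2 (W Q) p <= e0.
  apply: (hsubW Q P kap (Num.min (1 / 2) (s1 / 2))) => //.
    by rewrite lt_min !divr_gt0.
  move=> Q'; rewrite !lt_min => /andP[z1 _] /andP[_ z2].
  have bQ' : box xb (rho + 1) 0 T Q'.
    split.
      have := ler_enorm_dist Q'.1 Q.1 xb; have := ler_enorm_dist Q.1 P.1 xb.
      by rewrite -/a; clear -z1 anu nuh P1; lra.
    have [_ /andP[z3 z4]] := bQ; move: z2; rewrite ltr_norml => /andP[z5 z6].
    by apply/andP; split; clear -z3 z4 z5 z6 s10; lra.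
  by have := mule _ _ bQ' KP; rewrite -WQP /pen -/W; clear; lra.
have supP : 0 <= tau - mu * B P * lam + H P.1 P.2 (u P) p.
  have hphi := C1w_diff_of_opp (C1w_diff_of_add (C1w_quad (2 * kap)^-1 (2 * kap)^-1 Q.1 Q.2)
    (C1w_diff_of_scale mu (C1w_barrier lam N A2 b xb eta0))).
  have P2T : 0 < P.2 < T.
    by apply/andP; split; [clear -s00 P2s0 | clear -PT1 T1T]; lra.
  have nmin : \forall w \near P, u P - - ((2 * kap)^-1 * sqd P.1 Q.1
        + (2 * kap)^-1 * (P.2 - Q.2) ^+ 2 + mu * B P) <=
      u w - - ((2 * kap)^-1 * sqd w.1 Q.1
        + (2 * kap)^-1 * (w.2 - Q.2) ^+ 2 + mu * B w).
    near=> w.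
    have w2 : 0 <= w.2.
      apply: ltW; near: w.
      have sE : continuous (fun x : E => x.2) by move=> z; exact: cvg_snd.
      by have /andP[z1 _] := P2T; exact: (cvgr_gt _ (sE P) _ z1).
    have Zw : Z w <= Zm.
      by apply: ltW; near: w; exact: (cvgr_lt _ (Zc P) _ ZPm).
    have := mule _ _ KQ (DP _ w2 Zw).
    rewrite /pen (sqdC Q.1); move: WQP; rewrite /pen (sqdC Q.1); clear; lra.
  have := usup _ _ _ P hphi P2T nmin.
  set wB := mu *: _.
  have wBle : (A2 * enorm P.1 + B2) * enorm wB <= mu * B P * (N * (A2 * Z P)).
    rewrite /wB enormZ (gtr0_norm mugt0) mulrCA -[leRHS]mulrA ler_pM2l//.
    exact: barrier_speed.
  have -> : - (2 * (2 * kap)^-1 *: (P.1 - Q.1) + wB) = p - wB.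
    by rewrite opprD -scalerN opprB /p invfM mulrA divff// mul1r.
  have := Hp P.1 P.2 (u P) (p - wB) p.
  rewrite addrAC subrr sub0r enormN ler_norml => /andP[_].
  have -> : tau = - (2 * (2 * kap)^-1 * (P.2 - Q.2)).
    by rewrite /tau; field; rewrite gt_eqF.
  by move: wBle; rewrite -/Z -/B; clear; lra.
have pn : enorm p <= 4 * L.
  rewrite enormZ gtr0_norm ?invr_gt0// ler_pdivrMl// -/a.
  rewrite (_ : kap * _ = 4 * kap * L); last by ring.
  by clear -aa' a'ge0; lra.
have pa : enorm p * a <= 2 * pen Q P.
  rewrite enormZ gtr0_norm ?invr_gt0// -/a penE -mulrA -expr2 invfM.
  have : 0 <= kap^-1 * a' ^+ 2 by rewrite mulr_ge0 ?sqr_ge0// invr_ge0 ltW.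
  by clear; lra.
have sh1 : H P.1 P.2 (u P) p - H Q.1 P.2 (u P) p <=
    C1 * beta * (4 * kap * L) + C1 * (2 * (kap * (4 * L ^+ 2))).
  have := Hx P.2 (u P) p P.1 Q.1; rewrite ler_norml => /andP[_ z1].
  apply: le_trans z1 _; rewrite enormB -/a mulrDr mulrDl; apply: lerD.
    by apply: ler_wpM2l => //; clear -aa' a'ge0; lra.
  rewrite -mulrA; apply: ler_wpM2l => //; apply: le_trans pa _.
  by rewrite ler_pM2l.
have sh2 : H Q.1 P.2 (u P) p - H Q.1 Q.2 (u P) p < e0.
  have bQP : box xb (rho + 1) 0 T (Q.1, P.2) by split => //=; rewrite P2.
  have uPC : `|u P| <= C by apply: uC; split; [clear -P1; lra | rewrite P2].
  have td : `|P.2 - Q.2| < d3 by rewrite distrC -/a'; clear -a'nu nud d30; lra.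
  by have := hd3 _ _ _ _ _ bQP uPC pn td; rewrite ltr_norml => /andP[].
have sh3 : H Q.1 Q.2 (u P) p - H Q.1 Q.2 (W Q) p <=
    K3 * (mu * B P) + K3 * (kap * (4 * L ^+ 2)).
  have := Hu Q.1 Q.2 p (u P) (W Q); rewrite ler_norml => /andP[_ z1].
  apply: le_trans z1 _; rewrite -mulrDr; apply: ler_wpM2l => //.
  rewrite distrC ger0_norm.
    by clear -WQP penle; lra.
  by have := pen0 Q P; clear -WQP muBe e00; lra.
suff : 4 * e0 <= 3 * e0 by clear -e00; lra.
have lamE : mu * B P * lam = mu * B P + K3 * (mu * B P) by rewrite /lam; ring.
by clear -muBe lamE sh1 sh2 sh3 supP subQ errE kaperr k4; lra.
Unshelve. all: by end_near. Qed.

End ConeComparison.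

(** * The slope estimate for globally defined data *)

Section LowerBound.
Context {R : realType} {n : nat}.
Notation V := 'rV[R]_n.
Notation E := (V * R)%type.

(* A point minimizing [f + q * smooth_dist] inside the ball would carry a
   subgradient of norm at most [q < theta], so it lies on the sphere. *)
Lemma slope_descent (f : V -> R) (x : V) (rho theta q : R) :
  continuous f -> 0 < rho -> 0 < q -> q < theta ->
  (forall y p, enorm (y - x) <= rho -> subdiff f y p -> theta <= enorm p) ->
  exists2 y, enorm (y - x) <= rho & f y + q * rho <= f x.
Proof.
move=> fc rho0 q0 qth hf.
pose q1 := (q + theta) / 2.
have [qq1 q1th] : q < q1 /\ q1 < theta by rewrite /q1; split; lra.
have q10 : 0 < q1 by lra.
(* The smoothing raises the value at the centre by [q1 * eta], exactly the gain [(q1 - q) * rho]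
   from using the slope [q1] instead of [q]. *)
pose eta := (q1 - q) * rho / q1.
have eta0 : 0 < eta by rewrite divr_gt0// mulr_gt0// subr_gt0.
have q1eta : q1 * eta = (q1 - q) * rho by rewrite /eta; field; rewrite gt_eqF.
have hD := C1w_smooth_dist x eta0.
pose g y := f y + q1 * smooth_dist x eta y.
have gc : continuous g.
  by apply: contD => //; apply: contM; [exact: cont_cst | exact: C1w_continuous hD].
have [|y hy ymin] := compact_argmin _ (@eball_compact _ _ x rho) gc.
  by exists x; rewrite /= subrr enorm0 ltW.
have yx := ymin x; rewrite /= subrr enorm0 (ltW rho0) /g smooth_distxx// in yx.
have {}yx := yx isT.
exists y => //; have [ylt|yge] := ltP (enorm (y - x)) rho; last first.
  have := enorm_smooth_dist x eta y => h.
  have h1 : q1 * rho <= q1 * smooth_dist x eta y.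
    by rewrite ler_pM2l//; exact: le_trans yge h.
  by lra.
exfalso.
pose D := smooth_dist x eta y.
have D0 : 0 < D by exact: smooth_dist_gt0.
pose p := (- (q1 / D)) *: (y - x).
suff : theta <= enorm p.
  have qD : 0 < q1 / D by exact: divr_gt0.
  rewrite enormZ normrN (gtr0_norm qD) -mulrA => h.
  have : D^-1 * enorm (y - x) <= 1.
    by rewrite ler_pdivrMl// mulr1 enorm_smooth_dist.
  by move=> /(ler_wpM2l (ltW q10)); lra.
apply: (hf y) => //.
have hphi := C1w_scale (- q1) hD.
exists (fun z => - q1 * smooth_dist x eta z); split; first exact: C1w_C1_on hphi.
split; last first.
  apply/rowP => i; rewrite !mxE (C1w_diffE _ _ hphi) -/D /p dotv_evec !mxE; ring.
have gap : 0 < rho - enorm (y - x) by rewrite subr_gt0.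
have [d d0 hd] := @enorm_small R n _ gap.
apply/nbhs_ballP; exists d => // z; rewrite -ball_normE/= distrC => /hd zy.
have := ymin z; rewrite /g/= => h.
have : enorm (z - x) <= rho by have := ler_enorm_dist z y x; lra.
by move=> /h; lra.
Qed.

Lemma C1w_is_derive (f : R -> R) df s : C1w f df -> is_derive s (1 : R) f (df s 1).
Proof.
move=> h; have [fd _] := h; have fds := fd s.
have dfs : differentiable f s by exact: ex_diff.
by split; [exact: diff_derivable | rewrite deriveE// (C1w_diffE _ _ h)].
Qed.

Lemma C1w_id : C1w (fun s : R => s) (fun _ v => v).
Proof. by split => [z|v z]; [exact: is_diff_id | exact: cvg_cst]. Qed.

(** The choice of [kap] leaves [- beta / 2 * C1 * k * d^2] in the quadratic part and cancels the
    [th] terms. With the linear term [C1 * beta * d] and the derivative of [c] this completes a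
    square; what remains is nonpositive for [s >= 0]. *)
Lemma tilting_ineq (C1 beta K3 th k0 s d : R) (kap := (beta / 2 + 2) * C1 + K3) :
  0 <= C1 -> 0 <= beta -> 0 <= K3 -> 0 < k0 -> 0 <= s ->
  k0 * (expR (- kap * s) * (- kap * 1)) * d ^+ 2 +
    (4 * k0)^-1 * (th ^+ 2 * (expR (- K3 * s) * (- K3 * 1)) -
       2 * C1 * beta * (s * (expR (kap * s) * (kap * 1)) + expR (kap * s) * 1)) +
    C1 * (beta + 2 * (k0 * expR (- kap * s)) * d) * d +
    K3 * (k0 * expR (- kap * s) * d ^+ 2 +
      (4 * k0)^-1 * (th ^+ 2 * expR (- K3 * s) - 2 * C1 * beta * (s * expR (kap * s))))
  <= 0.
Proof.
move=> C10 b0 K30 k00 s0.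
have kap0 : 0 <= kap by rewrite /kap addr_ge0// mulr_ge0//; lra.
have -> : expR (- kap * s) = (expR (kap * s))^-1 by rewrite mulNr expRN.
have e0 : 0 < expR (kap * s) by exact: expR_gt0.
move: (expR (kap * s)) (expR (- K3 * s)) e0 => e f e0.
have -> : k0 * (e^-1 * (- kap * 1)) * d ^+ 2 +
    (4 * k0)^-1 * (th ^+ 2 * (f * (- K3 * 1)) -
       2 * C1 * beta * (s * (e * (kap * 1)) + e * 1)) +
    C1 * (beta + 2 * (k0 * e^-1) * d) * d +
    K3 * (k0 * e^-1 * d ^+ 2 +
      (4 * k0)^-1 * (th ^+ 2 * f - 2 * C1 * beta * (s * e))) =
  - (C1 * beta * ((k0 * d / e - 1) ^+ 2 * (e / (2 * k0)) +
      (kap + K3) * s * (e / (2 * k0)))).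
  by rewrite /kap; field; rewrite !gt_eqF.
rewrite oppr_le0 mulr_ge0 ?mulr_ge0//.
have ek : 0 <= e / (2 * k0) by rewrite ltW// divr_gt0// mulr_gt0.
by rewrite addr_ge0// mulr_ge0 ?sqr_ge0// mulr_ge0// addr_ge0.
Qed.

(** The spatial subgradient enters only through the one-sided bound [hloc] near [xb]; a large [k0]
    forces the witness of the cone comparison into that neighbourhood. *)
Theorem slope_lower_bound H C1 beta A2 B2 K3 (u : E -> R) (x0 xb : V)
    (r T tb theta th r1 q : R) (b := B2 / A2 + enorm xb)
    (K := (beta / 2 + 2) * C1 + 2 * K3) :
  hamiltonian H C1 beta A2 B2 K3 -> 0 < A2 -> continuous u ->
  subsolution T H u -> supersolution T H u ->
  0 < tb -> tb < T -> b * (expR (A2 * tb) - 1) + enorm (xb - x0) < r ->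
  0 < th -> th < theta ->
  (forall s, 0 <= s <= T -> 0 <= th ^+ 2 * expR (- (K * s)) - 2 * C1 * beta * s) ->
  (forall x p, eball x0 r x -> subdiff (fun y => u (y, 0)) x p -> theta <= enorm p) ->
  0 < r1 ->
  (forall y, enorm (y - xb) <= r1 -> u (xb, tb) - q * enorm (y - xb) <= u (y, tb)) ->
  th ^+ 2 * expR (- (K * tb)) - 2 * C1 * beta * tb <= q ^+ 2.
Proof.
move=> hH A20 uc usub usup tb0 tbT hcone th0 thth Qpos hslope r10 hloc.
have [Hc C10 beta0 B20 _ K30 Hx Hp Hu Hcvx] := hH.
have T0 : 0 < T by lra.
pose ee := expR (A2 * tb).
have ee1 : 1 <= ee by rewrite -expR0 ler_expR mulr_ge0// ltW.
have bge0 : 0 <= b by rewrite addr_ge0 ?enorm_ge0// divr_ge0// ltW.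
pose G := r - enorm (xb - x0) - b * (ee - 1).
have G0 : 0 < G by rewrite /G -/ee in hcone *; lra.
pose eta := G / 2 / ee.
have ee0 : 0 < ee by exact: expR_gt0.
have eta0 : 0 < eta by rewrite !divr_gt0.
have etae : (eta + b) * ee = b + (b * (ee - 1) + G / 2).
  by rewrite /eta; field; rewrite gt_eqF.
pose T1 := (tb + T) / 2.
have [T1a T1b] : tb < T1 /\ T1 < T by rewrite /T1; split; clear -tbT; lra.
have etab : 0 < eta + b by lra.
have zz : (eta + b) * ee < (eta + b) * expR (A2 * T1).
  by rewrite ltr_pM2l// ltr_expR ltr_pM2l.
(* The first entry leaves a collar of width [G / 4] between the base of the cone and the boundary of
   the ball of (U), so initial points can still be moved; the second closes the cone by [T1]. *)
pose rho := Num.min (b * (ee - 1) + G / 4 * 3) ((eta + b) * expR (A2 * T1) - b).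
have rho1 : (eta + b) * ee < b + rho.
  by rewrite -ltrBlDl /rho lt_min; apply/andP; split; lra.
have rho2 : b + rho <= (eta + b) * expR (A2 * T1).
  by rewrite -lerBrDl /rho ge_min lexx orbT.
have bee : 0 <= b * (ee - 1) by rewrite mulr_ge0// subr_ge0.
have rho0 : 0 < rho by lra.
have rhor : rho <= b * (ee - 1) + G / 4 * 3 by rewrite /rho ge_min lexx.
pose G2 := G / 4.
have G20 : 0 < G2 by rewrite divr_gt0.
have rhoG : rho + enorm (xb - x0) + G2 <= r by rewrite /G2 /G in rhor *; lra.
clearbody rho; clear zz etae rhor.
have [C C0 uC] := @box_bounded R n xb (rho + 1 + 3) 0 T u uc.
pose kap := (beta / 2 + 2) * C1 + K3.
have kap0 : 0 <= kap by rewrite /kap addr_ge0// mulr_ge0//; lra.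
have KE : K = kap + K3 by rewrite /K /kap; ring.
pose th1 := (th + theta) / 2.
have [th1a th1b] : th < th1 /\ th1 < theta by rewrite /th1; split; clear -thth; lra.
have th10 : 0 < th1 by clear -th0 th1a; lra.
(* The first summand keeps [k] above both [2 * C] and [2 * C / r1 ^+ 2] up to time [T], the latter
   placing the witness within [r1] of [xb]. The others make the initial displacement
   [th1 / (2 * k0)] smaller than the collar [G2] and than 1. *)
pose k0 := expR (kap * T) * (2 * C + 2 * C / r1 ^+ 2 + 1) + th1 / G2 + th1.
have c1 : 0 <= 2 * C / r1 ^+ 2 by rewrite divr_ge0 ?sqr_ge0// mulr_ge0// ltW.
have c2 : 0 <= th1 / G2 by rewrite ltW// divr_gt0.
have c3 : 0 <= expR (kap * T) * (2 * C + 2 * C / r1 ^+ 2 + 1).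
  by rewrite mulr_ge0// ?expR_ge0//; lra.
have k0E : expR (kap * T) * (2 * C + 2 * C / r1 ^+ 2 + 1) <= k0.
  by rewrite /k0; clear -c2 th10; lra.
have k0th : th1 <= k0 by rewrite /k0; clear -c2 c3; lra.
have k0G : th1 / G2 <= k0 by rewrite /k0; clear -c3 th10; lra.
have k00 : 0 < k0 by clear -k0th th10; lra.
clearbody k0; clear c2 c3.
pose k s := k0 * expR (- kap * s).
(* Chosen so that [4 * k s * c s = th ^+ 2 * expR (- (K * s)) - 2 * C1 * beta * s]. *)
pose c s := (4 * k0)^-1 * (th ^+ 2 * expR (- K3 * s) - 2 * C1 * beta * (s * expR (kap * s))).
have hk := C1w_scale k0 (C1w_exp (C1w_scale (- kap) C1w_id)).
have hc := C1w_scale (4 * k0)^-1 (C1w_add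
  (C1w_scale (th ^+ 2) (C1w_exp (C1w_scale (- K3) C1w_id)))
  (C1w_scale (-1) (C1w_scale (2 * C1 * beta)
     (C1w_mul C1w_id (C1w_exp (C1w_scale kap C1w_id)))))).
have cE s : c s = (4 * k0)^-1 * expR (kap * s) *
    (th ^+ 2 * expR (- (K * s)) - 2 * C1 * beta * s).
  rewrite /c KE (_ : - K3 * s = kap * s - (kap + K3) * s); last by ring.
  by rewrite expRD; ring.
have i4 : 0 < (4 * k0)^-1 by rewrite invr_gt0 mulr_gt0.
have C1b : 0 <= 2 * C1 * beta by rewrite !mulr_ge0.
have cle s : 0 <= s -> c s <= (4 * k0)^-1 * th ^+ 2.
  move=> s0; rewrite /c ler_pM2l//.
  have : th ^+ 2 * expR (- K3 * s) <= th ^+ 2 * 1.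
    by rewrite ler_wpM2l ?sqr_ge0// -expR0 ler_expR mulNr oppr_le0 mulr_ge0.
  have : 0 <= 2 * C1 * beta * (s * expR (kap * s)).
    by rewrite mulr_ge0// mulr_ge0// expR_ge0.
  by clear; lra.
have cge s : 0 <= s <= T -> 0 <= c s.
  by move=> sT; rewrite cE; apply: mulr_ge0; [rewrite mulr_ge0 ?expR_ge0// ltW | exact: Qpos].
have kle s : 0 <= s -> k s <= k0.
  move=> s0; rewrite /k -[leRHS]mulr1 ler_pM2l// -expR0 ler_expR mulNr oppr_le0.
  exact: mulr_ge0.
have kge s : 0 <= s <= T -> 2 * C + 2 * C / r1 ^+ 2 + 1 <= k s.
  move=> /andP[s0 sT]; rewrite -(ler_pM2l (expR_gt0 (kap * T))).
  apply: le_trans k0E _; rewrite /k mulrCA -expRD -[leLHS]mulr1 ler_pM2l//.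
  rewrite -expR0 ler_expR mulNr subr_ge0; exact: ler_wpM2l.
pose kM := k0 + (4 * k0)^-1 * th ^+ 2.
have i4th : 0 <= (4 * k0)^-1 * th ^+ 2 by rewrite mulr_ge0 ?sqr_ge0// ltW.
have hT : tilting u k (fun s => k0 * (expR (- kap * s) * (- kap * 1))) c
   (fun s => (4 * k0)^-1 * (th ^+ 2 * (expR (- K3 * s) * (- K3 * 1)) -
     2 * C1 * beta * (s * (expR (kap * s) * (kap * 1)) + expR (kap * s) * 1)))
   xb (rho + 1) T C kM.
  have hk' := hk; have hc' : C1w c (fun s v => (4 * k0)^-1 *
      (th ^+ 2 * (expR (- K3 * s) * (- K3 * v)) -
       2 * C1 * beta * (s * (expR (kap * s) * (kap * v)) + expR (kap * s) * v))).
    by apply: C1w_ext hc _ _ => [s|s v]; rewrite mulN1r.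
  split => //.
  - by rewrite addr_ge0// ltW.
  - by move=> s; exact: (C1w_is_derive s hk').
  - by move=> s; exact: (C1w_is_derive s hc').
  - exact: (hk'.2 1).
  - exact: (hc'.2 1).
  - move=> s sT; have := kge _ sT; have /andP[s0 _] := sT; have := kle _ s0.
    by rewrite /kM => h1 h2; apply/andP; split; clear -h1 h2 c1 i4th; lra.
  - by move=> s sT; have := kge _ sT; clear -c1 C0; lra.
  - move=> s sT; rewrite cge//=; have /andP[s0 _] := sT; have := cle _ s0.
    by rewrite /kM; clear -k00; lra.
have kc s d : 0 <= s <= T -> 0 <= d ->
    k0 * (expR (- kap * s) * (- kap * 1)) * d ^+ 2 +
    (4 * k0)^-1 * (th ^+ 2 * (expR (- K3 * s) * (- K3 * 1)) -
       2 * C1 * beta * (s * (expR (kap * s) * (kap * 1)) + expR (kap * s) * 1)) +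
    C1 * (beta + 2 * k s * d) * d + K3 * (k s * d ^+ 2 + c s) <= 0.
  by move=> /andP[s0 _] _; exact: tilting_ineq.
(* This maximizes [th1 * r - k0 * r^2], with maximum [th1^2 / (4 * k0)]. The excess [gap] over the
   initial value [th^2 / (4 * k0)] of [c] extends the comparison from time 0 to a short time
   interval. *)
pose rho3 := th1 / (2 * k0).
have rho30 : 0 < rho3 by rewrite divr_gt0// mulr_gt0.
have rho3G : rho3 < G2.
  rewrite ltr_pdivrMr ?mulr_gt0//; move: k0G; rewrite ler_pdivrMr//.
  by clear -th10; lra.
have rho34 : rho3 <= 1.
  by rewrite ler_pdivrMr ?mulr_gt0//; clear -k0th k00; lra.
pose gap := (th1 ^+ 2 - th ^+ 2) / (4 * k0).
have gap0 : 0 < gap.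
  by rewrite divr_gt0 ?mulr_gt0// subr_gt0 ltr_sqr ?nnegrE ?ltW.
have gap3 : 0 < gap / 3 by rewrite divr_gt0.
have [d d0 hd] := box_unif_continuous xb (rho + 4) 0 T uc gap3.
have u0c : continuous (fun y : V => u (y, 0)).
  apply: (cont_comp (f := fun y : V => (y, 0)) _ uc).
  by apply: (cont_pair (f := id)) => y; [exact: cvg_id | exact: cst_continuous].
have init x t : enorm (x - xb) <= rho -> 0 <= t <= d / 2 -> t <= T ->
    exists2 y, enorm (y - xb) <= rho + 4 & u (y, t) + k t * sqd y x + c t <= u (x, t).
  move=> xr /andP[t0 td] tT.
  have [|y yx yle] := slope_descent u0c rho30 th10 th1b (x := x).
    move=> y p yx; apply: hslope; rewrite /eball/=.
    have := ler_enorm_dist y x x0; have := ler_enorm_dist x xb x0.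
    by clear -yx xr rho3G rhoG; lra.
  have yb : enorm (y - xb) <= rho + 4.
    by have := ler_enorm_dist y x xb; clear -yx xr rho34; lra.
  exists y => //.
  have small z : enorm (z - xb) <= rho + 4 -> `|u (z, t) - u (z, 0)| < gap / 3.
    move=> zb; apply: hd => /=; first by split => //=; rewrite t0.
      by rewrite subrr enorm0.
    by rewrite subr0 ger0_norm//; clear -td d0; lra.
  have := small y yb; have : enorm (x - xb) <= rho + 4 by clear -xr; lra.
  move=> /small; rewrite !ltr_norml => /andP[s1 s2] /andP[s3 s4].
  have kt : k t * sqd y x <= k0 * rho3 ^+ 2.
    rewrite sqdE; apply: ler_pM; last by rewrite ler_sqr ?nnegrE ?enorm_ge0// ltW.
    - by rewrite mulr_ge0 ?expR_ge0// ltW.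
    - exact: sqr_ge0.
    - exact: kle.
  have ct := cle _ t0.
  have gapE : gap = th1 * rho3 - k0 * rho3 ^+ 2 - (4 * k0)^-1 * th ^+ 2.
    by rewrite /gap /rho3; field; rewrite gt_eqF.
  by clear -yle s1 s2 s3 s4 kt ct gapE gap0; lra.
have d20 : 0 < d / 2 by rewrite divr_gt0.
have [y yb] := cone_comparison hH usub usup A20 hT kc tb0 T1b eta0 (ltW rho0) d20
  rho1 rho2 init.
have tbT' : 0 <= tb <= T by rewrite !ltW.
have cb := cge _ tbT'; have kb := kge _ tbT'.
have kb0 : 0 < k tb by clear -kb c1 C0; lra.
move=> yle.
pose D := enorm (y - xb).
have D0 : 0 <= D by exact: enorm_ge0.
have Dr1 : D <= r1.
  have uy : `|u (y, tb)| <= C by apply: uC; split => //=; clear -yb; lra.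
  have ub : `|u (xb, tb)| <= C.
    by apply: uC; split => //=; rewrite subrr enorm0; clear -rho0; lra.
  rewrite -ler_sqr ?nnegrE ?(ltW r10)// -(ler_pM2l kb0).
  apply: le_trans (_ : 2 * C <= _).
    move: yle uy ub; rewrite sqdE -/D !ler_norml => h1 /andP[h2 h3] /andP[h4 h5].
    by clear -h1 h2 h5 cb; lra.
  apply: le_trans (_ : (2 * C / r1 ^+ 2) * r1 ^+ 2 <= _).
    by rewrite divfK// expf_neq0// gt_eqF.
  by rewrite ler_wpM2r ?sqr_ge0//; clear -kb C0; lra.
have := hloc _ Dr1; rewrite sqdE -/D in yle * => hq.
have -> : th ^+ 2 * expR (- (K * tb)) - 2 * C1 * beta * tb = 4 * k tb * c tb.
  rewrite cE /k (_ : expR (- kap * tb) = (expR (kap * tb))^-1); last by rewrite mulNr expRN.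
  by field; rewrite !gt_eqF// ?expR_gt0.
(* The quadratic [k D^2 - q D + c] takes a nonpositive value, so its discriminant is nonnegative:
   [4 k c <= q^2]. *)
have h1 : k tb * D ^+ 2 + c tb <= q * D by clear -hq yle; lra.
have h2 : 4 * k tb * (k tb * D ^+ 2 + c tb) <= 4 * k tb * (q * D).
  by rewrite ler_pM2l// mulr_gt0.
by have := sqr_ge0 (q - 2 * k tb * D); clear -h2; lra.
Qed.

End LowerBound.

(** * Clamping in time and the theorem *)

Section Reduction.
Context {R : realType} {n : nat}.
Notation V := 'rV[R]_n.
Notation E := (V * R)%type.

(** Freezing time makes [H] and [u] continuous on the whole space without changing them at the times
    where the equation is tested. *)
Definition clamp (a s : R) : R := Num.max 0 (Num.min s a).

Lemma clamp_bound a s : 0 <= a -> 0 <= clamp a s <= a.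
Proof. by move=> a0; rewrite /clamp le_max lexx/= ge_max a0 ge_min lexx orbT. Qed.

Lemma clamp_id a s : 0 <= s <= a -> clamp a s = s.
Proof. by move=> /andP[s0 sa]; rewrite /clamp (min_idPl sa) (max_idPr s0). Qed.

Lemma clamp_continuous a : continuous (clamp a).
Proof.
move=> s; apply: (@continuous_max R R (fun _ => 0) (fun s => Num.min s a)).
  exact: cvg_cst.
by apply: (@continuous_min R R id (fun _ => a)); [exact: cvg_id | exact: cvg_cst].
Qed.

Lemma within_continuous_comp {F G : topologicalType} (S : set G) (f : G -> R)
  (g : F -> G) : {within S, continuous f} -> continuous g ->
  (forall z, S (g z)) -> continuous (fun z => f (g z)).
Proof.
move=> /subspace_continuousP fc gc gS z.
move=> P /(fc _ (gS z)) h; have : \forall w \near z, S (g w) -> P (f (g w)).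
  exact: (gc z _ h).
by apply: filterS => w; apply; exact: gS.
Qed.

Lemma C1w_gradx (phi : E -> R) g tau z : C1w phi (diff_of g tau) -> gradx phi z = g z.
Proof.
move=> h; apply/rowP => i.
by rewrite mxE (C1w_diffE _ _ h) /diff_of/= mulr0 addr0 dotv_evec.
Qed.

Lemma C1w_dert (phi : E -> R) g tau z : C1w phi (diff_of g tau) -> dert phi z = tau z.
Proof.
by move=> h; rewrite /dert (C1w_diffE _ _ h) /diff_of/= dotvC dotv0l add0r mulr1.
Qed.

Lemma diff_gradx (phi : E -> R) z (v : V) : 'd phi z (v, 0) = dotv (gradx phi z) v.
Proof.
have -> : ((v, 0) : E) = \sum_i v 0 i *: ((evec i, 0) : E).
  rewrite [RHS]surjective_pairing; congr pair.
    rewrite (big_morph (fst : E -> V) (id1 := 0) (op1 := +%R))//.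
    exact: row_sum_delta.
  rewrite (big_morph (snd : E -> R) (id1 := 0) (op1 := +%R))// big1// => i _ /=.
  by rewrite scaler0.
rewrite linear_sum; apply: eq_bigr => i _.
by rewrite linearZ mxE mulrC.
Qed.

(** On the time slice only the Euclidean norm of [p] is kept, by Cauchy-Schwarz; [gam] absorbs the
    first-order remainder of the test function. *)
Lemma subdiff_slice (u : E -> R) (x : V) (t : R) (p : V) gam : 0 < gam ->
  subdiffx u (x, t) p ->
  exists2 r1, 0 < r1 & forall y, enorm (y - x) <= r1 ->
    u (x, t) - (enorm p + gam) * enorm (y - x) <= u (y, t).
Proof.
move=> gam0 [tau [phi [[dphi _] [hmin [gp _]]]]].
have /diff_locallyP[_ /eqaddoP/(_ _ gam0)/nbhs_ballP[d /= d0 hd]] := dphi (x, t) I.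
have [d1 d10 hd1] := nbhs_boxP hmin.
exists (Num.min (d / 2) d1); first by rewrite lt_min d10 divr_gt0.
move=> y; rewrite le_min => /andP[yd yd1].
have ylt : enorm (y - x) < d.
  by apply: le_lt_trans yd _; rewrite ltr_pdivrMr// ltr_pMr// ltr1n.
have bh : ball (0 : E) d ((y - x, 0) : E).
  rewrite -ball_normE/= sub0r normrN; apply: norm_pair_lt => /=.
    by apply: le_lt_trans ylt; exact: enorm_norm.
  by rewrite normr0.
have := hd _ bh; rewrite /= => h1.
have := hd1 (y, t); rewrite /= subrr normr0 (ltW d10) => /(_ yd1 isT) h2.
have hn : `|((y - x, 0) : E)| <= enorm (y - x).
  by rewrite {1}/Num.Def.normr/= ge_max normr0 enorm_ge0 enorm_norm.
have {}h1 : `|phi (y, t) - (phi (x, t) + dotv p (y - x))| <= gam * enorm (y - x).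
  rewrite -[p]/((p, tau).1) -gp -diff_gradx; apply: le_trans (ler_wpM2l (ltW gam0) hn).
  move: h1; rewrite (_ : (y, t) = ((y - x, 0) : E) + (x, t))//.
  by congr pair; rewrite /= ?subrK ?add0r.
have h3 := dotv_le p (y - x).
move: h1 h2 h3; rewrite !ler_norml => /andP[h1 _] h2 /andP[h3 _].
by lra.
Qed.

(** As [a -> 0] the left side tends to [B2 * t]. The bound [exp(a t) - 1 <= a t exp(a t)] cancels
    the pole and leaves a function continuous at [a = 0]. *)
Lemma small_speed (B2 X t G : R) : 0 <= B2 -> 0 <= X -> 0 <= t -> B2 * t < G ->
  exists2 a, 0 < a & (B2 / a + X) * (expR (a * t) - 1) < G.
Proof.
move=> B20 X0 t0 BG.
pose f a := (B2 + a * X) * t * expR (a * t).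
have fc : continuous f.
  have h1 := C1w_add (C1w_cst B2) (C1w_mul (@C1w_id R) (C1w_cst X)).
  have h2 := C1w_exp (C1w_mul (@C1w_id R) (C1w_cst t)).
  exact: C1w_continuous (C1w_mul (C1w_mul h1 (C1w_cst t)) h2).
have f0 : f 0 < G by rewrite /f mul0r addr0 mul0r expR0 mulr1.
have near1 : \forall a \near (0 : R), f a < G by exact: (cvgr_lt _ (fc 0) _ f0).
move: near1 => /nbhs_ballP[d /= d0 hd].
exists (d / 2); first by rewrite divr_gt0.
have d20 : 0 < d / 2 by rewrite divr_gt0.
have : f (d / 2) < G.
  apply: hd; rewrite -ball_normE/= sub0r normrN gtr0_norm//.
  by rewrite ltr_pdivrMr// ltr_pMr// ltr1n.
apply: le_lt_trans; move: (d / 2) d20 => a a0.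
have -> : (B2 / a + X) = (B2 + a * X) / a by field; rewrite gt_eqF.
rewrite /f -mulrA -[leRHS]mulrA; apply: ler_wpM2l.
  by rewrite addr_ge0// mulr_ge0// ltW.
rewrite ler_pdivrMl// mulrA -[X in _ <= X]mulrC.
have := expR_ge1Dx (- (a * t)); rewrite expRN => h.
have e0 : 0 < expR (a * t) by exact: expR_gt0.
have := ler_wpM2l (ltW e0) h; rewrite divff ?gt_eqF// mulrDr mulr1 mulrN.
lra.
Qed.

End Reduction.
Unset Implicit Arguments. Set Strict Implicit. Set Printing Implicit Defensive.

Theorem theorem1p3 (R : realType) (n : nat) (T : R)
  (H : 'rV[R]_n -> R -> R -> 'rV[R]_n -> R) (u0 : 'rV[R]_n -> R)
  (C1 beta A2 B2 K3 : R) (x0 : 'rV[R]_n) (r theta : R)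
  (u : 'rV[R]_n * R -> R) :
  (1 <= n)%N -> 0 < T ->
  (* H continuous on R^n x [0,T] x R x R^n *)
  {within [set w : 'rV[R]_n * R * R * 'rV[R]_n | 0 <= w.1.1.2 <= T],
     continuous (fun w => H w.1.1.1 w.1.1.2 w.1.2 w.2)} ->
  (* u0 Lipschitz *)
  (exists L : R, forall x y, `|u0 x - u0 y| <= L * enorm (x - y)) ->
  (* (H1) *)
  0 <= C1 -> (beta = 0 \/ beta = 1) ->
  (forall t v p x y, 0 <= t <= T ->
     `|H x t v p - H y t v p| <= C1 * (beta + enorm p) * enorm (x - y)) ->
  (* (H2) *)
  0 <= A2 -> 0 <= B2 ->
  (forall x t v p q, 0 <= t <= T ->
     `|H x t v p - H x t v q| <= (A2 * enorm x + B2) * enorm (p - q)) ->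
  (* (H3) *)
  0 <= K3 ->
  (forall x t p v w, 0 <= t <= T ->
     `|H x t v p - H x t w p| <= K3 * `|v - w|) ->
  (* (H4) *)
  (forall x t v p q (l : R), 0 <= t <= T -> 0 <= l <= 1 ->
     H x t v (l *: p + (1 - l) *: q) <= l * H x t v p + (1 - l) * H x t v q) ->
  (* (U) *)
  0 < r -> 0 < theta ->
  (forall x p, eball x0 r x -> subdiff u0 x p -> theta <= enorm p) ->
  (* u is a viscosity solution of (1.1)-(1.2) *)
  viscosity_solution T H u0 u ->
  forall t0 : R, 0 < t0 <= T ->
  0 < theta ^+ 2 * expR (- (((beta / 2 + 2) * C1 + 2 * K3) * t0))
        - 2 * C1 * beta * t0 ->
  forall (x : 'rV[R]_n) (t : R), Eset T A2 B2 x0 r (x, t) -> t < t0 ->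
  forall p, subdiffx u (x, t) p ->
    Num.sqrt (theta ^+ 2 * expR (- (((beta / 2 + 2) * C1 + 2 * K3) * t))
              - 2 * C1 * beta * t) <= enorm p.
Proof.
move=> n1 T0 Hc _ C10 beta01 H1 A20 B20 H2 K30 H3 H4 r0 theta0 HU.
move=> [uc [uinit visc]] t0 /andP[t00 t0T] Q0 x t [xr [/andP[tp tT] hR]] tt0 p hp.
have beta0 : 0 <= beta by case: beta01 => ->.
set K := (beta / 2 + 2) * C1 + 2 * K3 in Q0 *.
have K0 : 0 <= K.
  by rewrite /K addr_ge0// mulr_ge0// addr_ge0// divr_ge0.
simpl in tp, tT, hR.
rewrite -(ger0_norm (enorm_ge0 p)) -sqrtr_sqr; apply: ler_wsqrtr.
rewrite leNgt; apply/negP => Qlt.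
set Q := _ - _ in Qlt.
(* Continuity of [u] stops short of [T], so its time is frozen at [T' < T]; [T' < t0] keeps the
   bound positive up to [T']. The Hamiltonian, continuous up to [T], is frozen at [T]. *)
pose T' := (t + t0) / 2.
have [T'1 T'2] : t < T' /\ T' < t0 by rewrite /T'; split; lra.
have T'0 : 0 < T' by lra.
have T'T : T' < T by lra.
pose H' y s v q := H y (clamp T s) v q.
pose u' (z : 'rV[R]_n * R) := u (z.1, clamp T' z.2).
have cT s := clamp_bound s (ltW T0).
have cT' s := clamp_bound s (ltW T'0).
have u'E z : 0 <= z.2 <= T' -> u' z = u z.
  by move=> z2; rewrite /u' clamp_id// -surjective_pairing.
have u'c : continuous u'.
  apply: (within_continuous_comp (g := fun z => (z.1, clamp T' z.2)) uc).
    apply: (cont_pair (f := fst)) => z; first exact: cvg_fst.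
    apply: (cont_comp (f := snd) _ (@clamp_continuous R T')).
    by move=> w; exact: cvg_snd.
  by move=> z /=; have /andP[-> /le_lt_trans ->] := cT' z.2.
(* (H2) still holds after enlarging [A2]; a small enlargement keeps [(x, t)] in
   the cone and makes [A2] positive. *)
have [a a0 [aA2 hcone]] : exists2 a, 0 < a & A2 <= a /\
    (B2 / a + enorm x) * (expR (a * t) - 1) + enorm (x - x0) < r.
  move: hR; rewrite /Rfun; case: ifPn => [A2p hR|A2n]; first by exists A2.
  have -> : A2 = 0 by apply/eqP; rewrite eq_le A20 leNgt A2n.
  rewrite -ltrBrDr => /(small_speed B20 (enorm_ge0 x) (ltW tp))[a a0 ha].
  by exists a => //; rewrite (ltW a0) -ltrBrDr.
have hH : hamiltonian H' C1 beta a B2 K3.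
  split => //; [ | exact: ltW | | | | ].
  - apply: (within_continuous_comp
      (g := fun w : 'rV[R]_n * R * R * 'rV[R]_n =>
        (w.1.1.1, clamp T w.1.1.2, w.1.2, w.2)) Hc _ (fun w => cT _)).
    have f1 : continuous (fun w : 'rV[R]_n * R * R * 'rV[R]_n => w.1).
      by move=> w; exact: cvg_fst.
    have f2 : continuous (fun w : 'rV[R]_n * R * R => w.1) by move=> w; exact: cvg_fst.
    have f3 : continuous (fun w : 'rV[R]_n * R => w.1) by move=> w; exact: cvg_fst.
    have g1 : continuous (fun w : 'rV[R]_n * R * R * 'rV[R]_n => w.2).
      by move=> w; exact: cvg_snd.
    have g2 : continuous (fun w : 'rV[R]_n * R * R => w.2) by move=> w; exact: cvg_snd.
    have g3 : continuous (fun w : 'rV[R]_n * R => w.2) by move=> w; exact: cvg_snd.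
    apply: (cont_pair _ g1).
    apply: (cont_pair _ (cont_comp f1 g2)).
    apply: (cont_pair (cont_comp f1 (cont_comp f2 f3))).
    exact: (cont_comp (cont_comp f1 (cont_comp f2 g3)) (@clamp_continuous R T)).
  - by move=> s v q y z; exact: H1.
  - move=> y s v q q'; apply: le_trans (H2 _ _ _ _ _ (cT s)) _.
    rewrite ler_wpM2r ?enorm_ge0// lerD2r ler_wpM2r ?enorm_ge0//.
  - by move=> y s q v w; exact: H3.
  - by move=> y s v q q' l; exact: H4.
have near_eq (z : 'rV[R]_n * R) : 0 < z.2 < T' -> \forall w \near z, u' w = u w.
  move=> /andP[z1 z2].
  have sc : continuous (fun w : 'rV[R]_n * R => w.2) by move=> w; exact: cvg_snd.
  near=> w; apply: u'E; apply/andP; split; apply: ltW; near: w.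
    exact: (cvgr_gt _ (sc z) _ z1).
  exact: (cvgr_lt _ (sc z) _ z2).
have HE z : 0 < z.2 < T' -> forall v q, H' z.1 z.2 v q = H z.1 z.2 v q.
  move=> /andP[z1 z2] v q; rewrite /H' clamp_id//.
  by rewrite (ltW z1)/= ltW// (lt_trans z2).
have zT (z : 'rV[R]_n * R) : 0 < z.2 < T' -> 0 < z.2 < T.
  by move=> /andP[-> z2]; rewrite (lt_trans z2).
have usub : subsolution T' H' u'.
  move=> phi g tau z hphi z2 zmax.
  have /andP[z21 z22] := z2.
  have [visc1 _] := visc phi z (C1w_C1_on _ hphi) (zT _ z2).
  rewrite HE// u'E; last by rewrite !ltW.
  rewrite -(C1w_dert z hphi) -(C1w_gradx z hphi); apply: visc1.
  have uz : u' z = u z by apply: u'E; rewrite !ltW.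
  have nq := near_eq _ z2.
  by near=> w; rewrite -uz -(near nq w)//; near: w.
have usup : supersolution T' H' u'.
  move=> phi g tau z hphi z2 zmax.
  have /andP[z21 z22] := z2.
  have [_ visc2] := visc phi z (C1w_C1_on _ hphi) (zT _ z2).
  rewrite HE// u'E; last by rewrite !ltW.
  rewrite -(C1w_dert z hphi) -(C1w_gradx z hphi); apply: visc2.
  have uz : u' z = u z by apply: u'E; rewrite !ltW.
  have nq := near_eq _ z2.
  by near=> w; rewrite -uz -(near nq w)//; near: w.
pose q0 := enorm p.
have q00 : 0 <= q0 by exact: enorm_ge0.
have D0 : 0 < Q - q0 ^+ 2 by rewrite subr_gt0.
pose gam := Num.min 1 ((Q - q0 ^+ 2) / 4 / (2 * q0 + 1)).
have q01 : 0 < 2 * q0 + 1 by clear -q00; lra.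
have gam0 : 0 < gam by rewrite lt_min ltr01 !divr_gt0.
have gam1 : gam <= 1 by rewrite /gam ge_min lexx.
have gamq : gam * (2 * q0 + 1) <= (Q - q0 ^+ 2) / 4.
  by rewrite -ler_pdivlMr// /gam ge_min lexx orbT.
pose P0 := theta ^+ 2 * expR (- (K * t0)) - 2 * C1 * beta * t0.
(* Replacing [theta] by [theta - ep] costs at most [2 * theta * ep]: at most a quarter of the
   assumed gap [Q - q0 ^+ 2], and at most [P0], so the bound stays nonnegative at [t0] and hence at
   earlier times. *)
pose ep := Num.min (theta / 2) (Num.min ((Q - q0 ^+ 2) / 4) P0 / (2 * theta)).
have theta2 : 0 < 2 * theta by exact: mulr_gt0.
have mp : 0 < Num.min ((Q - q0 ^+ 2) / 4) P0 by rewrite lt_min divr_gt0.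
have ep0 : 0 < ep by rewrite lt_min !divr_gt0.
have eph : ep <= theta / 2 by rewrite /ep ge_min lexx.
have epm : 2 * theta * ep <= Num.min ((Q - q0 ^+ 2) / 4) P0.
  by rewrite mulrC -ler_pdivlMr// /ep ge_min lexx orbT.
move: epm; rewrite le_min => /andP[epQ epP].
pose th := theta - ep.
have th0 : 0 < th by rewrite /th; clear -eph theta0; lra.
have thlt : th < theta by rewrite /th; clear -ep0; lra.
have thE : theta ^+ 2 - th ^+ 2 <= 2 * theta * ep.
  by rewrite /th; have := sqr_ge0 ep; clear; lra.
have tsq : th ^+ 2 <= theta ^+ 2.
  by rewrite ler_sqr ?nnegrE ltW.
have th_exp s : 0 <= s ->
    theta ^+ 2 * expR (- (K * s)) - 2 * theta * ep <= th ^+ 2 * expR (- (K * s)).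
  move=> s0; have : (theta ^+ 2 - th ^+ 2) * expR (- (K * s)) <= (theta ^+ 2 - th ^+ 2) * 1.
    rewrite ler_wpM2l ?subr_ge0// -expR0 ler_expR oppr_le0 mulr_ge0//.
  by clear -thE; lra.
have C1b : 0 <= 2 * C1 * beta by rewrite !mulr_ge0.
have Qpos s : 0 <= s <= T' -> 0 <= th ^+ 2 * expR (- (K * s)) - 2 * C1 * beta * s.
  move=> /andP[s0 sT].
  have st0 : s <= t0 by rewrite (le_trans sT)// ltW.
  have h1 : th ^+ 2 * expR (- (K * t0)) <= th ^+ 2 * expR (- (K * s)).
    by rewrite ler_wpM2l ?sqr_ge0// ler_expR lerN2 ler_wpM2l.
  have h2 : 2 * C1 * beta * s <= 2 * C1 * beta * t0 by rewrite ler_wpM2l.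
  have := th_exp t0 (ltW t00).
  by move: epP; rewrite /P0; clear -h1 h2; lra.
have hslope y q : eball x0 r y -> subdiff (fun y => u' (y, 0)) y q -> theta <= enorm q.
  move=> yr; rewrite (_ : (fun y => u' (y, 0)) = u0); first exact: HU.
  by apply/funext => z; rewrite u'E ?uinit//= lexx ltW.
have [r1 r10 hloc] := subdiff_slice gam0 hp.
have hloc' y : enorm (y - x) <= r1 ->
    u' (x, t) - (enorm p + gam) * enorm (y - x) <= u' (y, t).
  by move=> /hloc; rewrite !u'E//= !ltW.
have := slope_lower_bound hH a0 u'c usub usup tp T'1 hcone th0 thlt Qpos hslope r10 hloc'.
rewrite -/K -/q0 => bound.
have := th_exp t (ltW tp).
have e1 : (q0 + gam) ^+ 2 <= q0 ^+ 2 + gam * (2 * q0 + 1).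
  have : gam * gam <= gam * 1 by rewrite ler_pM2l.
  by clear; lra.
by move: bound gamq e1 epQ D0; rewrite /Q; clear; lra.
Unshelve. all: by end_near. Qed.
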